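(* Let $q\in(0,1)$ and let $I_q=\int_0^\infty q^{S_t}\,dt$ (that is, the case of zero drift, $\mu=0$). Then $I_q$ has the probability density function $$\phi_q(x)=\frac{\lambda\,\mathsf{P}\{Z_1\ge 1\}}{\sum_{j=0}^\infty c_jq^j}\sum_{j=0}^\infty c_j\exp\bigl(-\lambda\,\mathsf{P}\{Z_1\ge1\}\,q^{-j}x\bigr),\qquad x>0,$$ where the real coefficients $c_j$ are determined by the recurrence relation $$c_0=1,\qquad c_j=\frac{1}{(1-q^{-j})\,\mathsf{P}\{Z_1\ge1\}}\sum_{k=1}^{j}q^{-k}\,\mathsf{P}\{Z_1=k\}\,c_{j-k},\qquad j\in\{1,2,\dots\}.$$
   Context: An integer-valued subordinator (IVS) $S=(S_t)_{t\ge0}$ is a driftless Lévy process with nondecreasing paths, started at $0$, whose Lévy measure is supported on the positive integers. It is written in compound Poisson form $S_t=\sum_{i=1}^{N_t}Z_i$, $t\ge0$, where $N$ is a Poisson process with intensity $\lambda>0$ and $(Z_i)_{i\ge1}$ is an i.i.d. sequence of nonnegative integer-valued random variables, independent of $N$, with $\mathsf{P}\{Z_1\ge1\}>0$. *)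

(* Defs.v *)
From HB Require Import structures.
From mathcomp Require Import all_boot all_order all_algebra.
From mathcomp Require Import all_classical all_reals all_analysis.
From mathcomp Require Import measurable_realfun.

Set Implicit Arguments.
Unset Strict Implicit.
Unset Printing Implicit Defensive.

Import Order.TTheory GRing.Theory Num.Theory.
Import numFieldNormedType.Exports.

Local Open Scope classical_set_scope.
Local Open Scope ring_scope.

(* Product rule over every finite subfamily of the random variables X i. *)
Definition mutually_independent (d d' : measure_display) (T : measurableType d)
    (U : measurableType d') (R : realType) (P : probability T R)
    (I : choiceType) (X : I -> T -> U) : Prop :=
  forall (s : seq I) (B : I -> set U), uniq s ->
    (forall i, i \in s -> measurable (B i)) ->
    fine (P (\bigcap_(i in [set` s]) X i @^-1` B i)) =
    \prod_(i <- s) fine (P (X i @^-1` B i)).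

Definition sigma_family (d d' : measure_display) (T : measurableType d)
    (U : measurableType d') (I : Type) (D : set I) (X : I -> T -> U) :
    set (set T) :=
  <<s \bigcup_(i in D) preimage_set_system setT (X i) measurable >>.

Definition independent_systems (d : measure_display) (T : measurableType d)
    (R : realType) (P : probability T R) (F G : set (set T)) : Prop :=
  forall A B : set T, F A -> G B -> P (A `&` B) = (P A * P B)%E.

(* Processes are functions of t : R of which only the values at t >= 0 matter.
   As paths are nondecreasing, the truncated difference of two values of N is
   the increment; nat carries its discrete topology in the right-continuity
   condition. *)
Record poisson_process (d : measure_display) (T : measurableType d)
    (R : realType) (P : probability T R) (lam : R) (N : R -> T -> nat) :
    Prop := {
  poisson_measurable : forall t, 0 <= t -> measurable_fun setT (N t) ;
  poisson_start : forall w, N 0 w = 0%N ;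
  poisson_nondecreasing : forall s t w, 0 <= s -> s <= t ->
    (N s w <= N t w)%N ;
  poisson_right_continuous : forall t w, 0 <= t ->
    N s w @[s --> t^'+] --> N t w ;
  poisson_increments : forall (s t : R) (k : nat), 0 <= s -> s < t ->
    P [set w | (N t w - N s w)%N = k] =
    (poisson_pmf (lam * (t - s)) k)%:E ;
  poisson_independent_increments : forall t : nat -> R,
    0 <= t 0%N -> (forall i, t i <= t i.+1) ->
    mutually_independent P (fun (i : nat) w => (N (t i.+1) w - N (t i) w)%N) }.

(* The sequence Z_1, Z_2, ... is indexed from 0: Z_i is represented by
   Z i.-1. *)
Definition compound_sum (T R : Type) (N : R -> T -> nat) (Z : nat -> T -> nat)
    (t : R) (w : T) : nat :=
  (\sum_(i < N t w) Z i w)%N.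

Record integer_valued_subordinator (d : measure_display)
    (T : measurableType d) (R : realType) (P : probability T R) (lam : R)
    (N : R -> T -> nat) (Z : nat -> T -> nat) (S : R -> T -> nat) : Prop := {
  ivs_intensity : 0 < lam ;
  ivs_poisson : poisson_process P lam N ;
  ivs_measurable : forall i, measurable_fun setT (Z i) ;
  ivs_independent : mutually_independent P Z ;
  ivs_identically_distributed : forall i (B : set nat), measurable B ->
    P (Z i @^-1` B) = P (Z 0%N @^-1` B) ;
  ivs_independent_of_poisson :
    independent_systems P (sigma_family [set t : R | 0 <= t] N)
                          (sigma_family [set: nat] Z) ;
  ivs_nontrivial : (0 < P [set w | (1 <= Z 0%N w)%N])%E ;
  ivs_compound : forall t w, 0 <= t -> S t w = compound_sum N Z t w }.

Definition exponential_functional (T : Type) (R : realType) (q : R)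
    (S : R -> T -> nat) (w : T) : \bar R :=
  (\int[@lebesgue_measure R]_(t in `[0%R, +oo[) (q ^+ S t w)%:E)%E.

Definition has_density (d : measure_display) (T : measurableType d)
    (R : realType) (P : probability T R) (X : T -> \bar R) (f : R -> R) :
    Prop :=
  [/\ measurable_fun setT X,
      {ae P, forall w, X w \is a fin_num},
      measurable_fun setT f,
      (forall x, 0 <= f x) &
      forall A : set R, measurable A ->
        P (X @^-1` (EFin @` A)) =
        (\int[@lebesgue_measure R]_(x in A) (f x)%:E)%E].

Definition coef_recurrence (R : realType) (q : R) (p : nat -> R) (p1 : R)
    (c : nat -> R) : Prop :=
  c 0%N = 1 /\
  forall j : nat, (1 <= j)%N ->
    c j = ((1 - q ^- j) * p1)^-1 *
          \sum_(1 <= k < j.+1) q ^- k * p k * c (j - k)%N.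

Definition normalizer_term (R : realType) (q : R) (c : nat -> R) : R^nat :=
  fun j => c j * q ^+ j.

Definition phi_term (R : realType) (q lam p1 : R) (c : nat -> R) (x : R) :
    R^nat :=
  fun j => c j * expR (- (lam * p1 * q ^- j * x)).

Definition phi (R : realType) (q lam p1 : R) (c : nat -> R) (x : R) : R :=
  lam * p1 / limn (series (normalizer_term q c)) *
  limn (series (phi_term q lam p1 c x)).

(* Main.v *)
Require Import Defs.
From HB Require Import structures.
From mathcomp Require Import all_boot all_order all_algebra.
From mathcomp Require Import all_classical all_reals all_analysis.
From mathcomp Require Import measurable_realfun.
From mathcomp Require Import ring lra.

(** Let [a = lam * P (Z >= 1)], let [I] be the exponential functional and let
    [D = \sum_j c_j q ^ j].  The formula comes from an explicit tail function:
    put [V x = D ^-1 * \sum_j c_j q ^ j exp (- a q ^- j x)] for [x >= 0] and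
    [V x = 1] for [x <= 0].  The proposed density [f] is minus the derivative of
    [V], so that it suffices to show [P (x < I) = V x] for all [x]; integration
    of [f] over rays then identifies the law ([density_from_rays]).  That [f] is
    nonnegative and that [I] is almost surely finite are consequences.

    The analytic half is one identity.  Multiplied by [q ^ j], the recurrence is
    a convolution with the law of [Z], and summing it against bounded weights [e]
    gives ([pairing_recurrence])
      [p1 * \sum_j c_j e_j
         = \sum_j c_j q ^ j e_j - E (\sum_j c_j q ^ j e_(j + Z))].
    The weights [q ^ (n * j)] show that [D > 0]; the weight 1 shows that [f]
    vanishes at 0, so that [V] is continuously differentiable on the line; the
    exponential weights give [E (V (q ^- Z * x)) = V x - f x / lam].

    The probabilistic half reads the last equation as harmonicity.  The level
    [X_t = q ^- S_t * (x - \int_0^t q ^ S)] drifts at speed -1 and is multiplied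
    by [q ^- Z] at rate [lam], so that [V (X_t)] has constant expectation [V x].
    If [I > x], then [X_t] ends up negative, where [V] is 1; if [I < x], then
    [X_t] tends to infinity, where [V] tends to 0.  Hence
    [`|V x - P (x < I)| <= K * P (I = x)] with a bound [K] of [V], and the
    right-hand side disappears when [x] is approached from the right
    ([tail_fun_approx], [tail_funE]).

    Harmonicity is used on time grids only.  Given the past, a cell of length [h]
    contains no jump, one fresh jump or, with a probability of order [h ^ 2], more
    ([grid_increment_given_past]).  As [V] has a uniformly continuous derivative,
    one step changes the expectation by [o(h)] ([residual_step]), and the sum of
    these errors vanishes with the mesh.  The paths of [q ^ S] are nonincreasing,
    so that their Riemann sums are within one mesh of the integral
    ([riemann_sum_cvg]). *)

Set Implicit Arguments.
Unset Strict Implicit.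
Unset Printing Implicit Defensive.

Import Order.TTheory GRing.Theory Num.Theory.
Import numFieldNormedType.Exports.

Local Open Scope classical_set_scope.
Local Open Scope ring_scope.

(** * Bounded random variables and countable partitions *)

Section BoundedIntegrals.
Context {d : measure_display} {T : measurableType d} {R : realType}.
Variable P : probability T R.
Implicit Types (D : set T) (f : T -> R).

Lemma bounded_integrable D f K : measurable D -> measurable_fun setT f ->
  (forall w, D w -> `|f w| <= K) -> P.-integrable D (EFin \o f).
Proof.
move=> mD mf fK; apply: measurable_bounded_integrable => //.
- by rewrite (le_lt_trans (probability_le1 P mD)) ?ltry.
- exact: measurable_funTS.
- exists K; split; rewrite ?num_real// => M KM w Dw /=.
  by rewrite (le_trans (fK w Dw)) ?ltW.
Qed.

Lemma bounded_Rintegral_le D f K : measurable D -> measurable_fun setT f ->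
  (forall w, D w -> `|f w| <= K) -> `|\int[P]_(w in D) f w| <= K * fine (P D).
Proof.
move=> mD mf fK; apply: le_trans (le_normr_Rintegral mD (bounded_integrable mD mf fK)) _.
rewrite -Rintegral_cst//; apply: le_Rintegral => //.
- apply: (@bounded_integrable D (fun w => `|f w|) K) => //.
    exact: measurableT_comp.
  by move=> w Dw; rewrite normr_id fK.
- exact: finite_measure_integrable_cst.
Qed.

Lemma Rintegral_cstT (r : R) : \int[P]_(_ in setT) r = r.
Proof.
have PT : fine (P setT) = 1 by rewrite probability_setT.
by have := Rintegral_cst P measurableT r; rewrite PT mulr1.
Qed.

Lemma bounded_convergence D (f_ : nat -> T -> R) f K : measurable D ->
  (forall n, measurable_fun setT (f_ n)) -> measurable_fun setT f ->
  (forall n w, `|f_ n w| <= K) ->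
  (forall w, D w -> f_ n w @[n --> \oo] --> f w) ->
  \int[P]_(w in D) f_ n w @[n --> \oo] --> \int[P]_(w in D) f w.
Proof.
move=> mD mf_ mf f_K f_f.
have [|||||fi _ lim] := @dominated_convergence _ _ _ P D mD
  (fun n => EFin \o f_ n) (EFin \o f) (EFin \o cst K).
- by move=> n; apply/measurable_EFinP; exact: measurable_funTS.
- by apply/measurable_EFinP; exact: measurable_funTS.
- apply: aeW => w Dw; apply: cvg_EFin; last exact: f_f.
  exact: nearW.
- exact: finite_measure_integrable_cst.
- by apply: aeW => w n _ /=; rewrite lee_fin.
apply: fine_cvg; rewrite fineK//; first exact: integrable_fin_num.
Qed.

Lemma nat_fun_measurable (U : T -> nat) :
  (forall k, measurable (U @^-1` [set k])) -> measurable_fun setT U.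
Proof.
move=> mU _ B _; rewrite setTI.
have -> : U @^-1` B = \bigcup_(k in B) U @^-1` [set k].
  by apply/seteqP; split => [w Bw|w [k Bk /= ->]//]; exists (U w).
exact: bigcup_measurable.
Qed.

Lemma nat_fun_preimage (U : T -> nat) (B : set nat) :
  measurable_fun setT U -> measurable (U @^-1` B).
Proof. by move=> mU; rewrite -[X in measurable X]setTI; exact: mU. Qed.

Lemma Rintegral_partition D f K (U : T -> nat) : measurable D ->
  measurable_fun setT f -> (forall w, `|f w| <= K) -> measurable_fun setT U ->
  series (fun k => \int[P]_(w in D `&` U @^-1` [set k]) f w) @ \oo -->
  \int[P]_(w in D) f w.
Proof.
move=> mD mf fK mU; pose L n := U @^-1` [set k | (k < n)%N].
have mL n : measurable (L n) by exact: nat_fun_preimage.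
have int_if (E : set T) : measurable E -> P.-integrable E (EFin \o f).
  by move=> mE; apply: (@bounded_integrable E f K) => // w _.
rewrite (_ : series _ = fun n => \int[P]_(w in D) (f \_ (L n)) w); last first.
  apply/funext => n; rewrite -Rintegral_mkcondr; elim: n => [|n IHn].
    rewrite /series/= big_geq// (_ : L 0%N = set0) ?setI0 ?Rintegral_set0//.
    by apply/seteqP; split.
  rewrite seriesSr IHn -Rintegral_setU//.
  - congr (Rintegral _ _ _); rewrite -setIUr; congr (_ `&` _).
    apply/seteqP; split => w; rewrite /L/=; first by move=> [/ltnW|->].
    by rewrite ltnS leq_eqVlt => /predU1P[]; [right|left].
  - exact: measurableI.
  - by apply: measurableI => //; exact: nat_fun_preimage.
  - apply: int_if; apply: measurableU; apply: measurableI => //.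
    exact: nat_fun_preimage.
  - apply/disj_setPS => w [[_ +] [_ +]]; rewrite /L/= => /[swap] ->.
    by rewrite ltnn.
apply: (@bounded_convergence _ _ _ K) => //.
- by move=> n; apply/(measurable_restrictT _ _).1 => //; exact: measurable_funTS.
- move=> n w; rewrite patchE; case: ifP => // _; rewrite normr0.
  exact: le_trans (fK w).
- move=> w _; apply: cvg_near_cst; near=> n.
  rewrite patchE ifT// inE /L/=; near: n.
  exact: nbhs_infty_gt.
Unshelve. all: by end_near. Qed.

Lemma Rintegral_setIC D B f K : measurable D -> measurable B ->
  measurable_fun setT f -> (forall w, `|f w| <= K) ->
  \int[P]_(w in D) f w =
  \int[P]_(w in D `&` B) f w + \int[P]_(w in D `&` ~` B) f w.
Proof.
move=> mD mB mf fK; have mCB := measurableC mB.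
have ifD := bounded_integrable mD mf (fun w _ => fK w).
rewrite -Rintegral_setU -?setIUr ?setUv ?setIT//; try exact: measurableI.
by apply/disj_setPS => w [[_ ?] [_ ?]].
Qed.

Lemma fine_measure_setIC D B : measurable D -> measurable B ->
  fine (P D) = fine (P (D `&` B)) + fine (P (D `&` ~` B)).
Proof.
move=> mD mB; have := @Rintegral_setIC D B (cst 1) 1 mD mB.
rewrite !Rintegral_cst ?mul1r; try by apply: measurableI => //; exact: measurableC.
  by apply => // w; rewrite normr1.
by [].
Qed.

End BoundedIntegrals.

Section DiscreteVariables.
Context {d : measure_display} {T : measurableType d} {R : realType}.
Variable P : probability T R.
Implicit Types (D : set T) (U : T -> nat) (F : nat -> R).

Lemma nat_fun_comp U F : measurable_fun setT U ->
  measurable_fun setT (fun w => F (U w)).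
Proof.
move=> mU _ B _; rewrite setTI.
by rewrite -[_ @^-1` _]/(U @^-1` (F @^-1` B)); exact: nat_fun_preimage.
Qed.

Lemma Rintegral_discrete D F K U : measurable D -> (forall k, `|F k| <= K) ->
  measurable_fun setT U ->
  series (fun k => F k * fine (P (D `&` U @^-1` [set k]))) @ \oo -->
  \int[P]_(w in D) F (U w).
Proof.
move=> mD FK mU.
rewrite (_ : (fun k => _) = fun k => \int[P]_(w in D `&` U @^-1` [set k]) F (U w)).
  by apply: (@Rintegral_partition _ _ _ _ _ _ K) => //; exact: nat_fun_comp.
apply/funext => k; rewrite -Rintegral_cst.
  by apply: eq_Rintegral => w; rewrite inE => -[_ /= ->].
by apply: measurableI => //; exact: nat_fun_preimage.
Qed.

Lemma Rintegral_finite_support F n U : measurable_fun setT U ->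
  (forall k, (n <= k)%N -> F k = 0) ->
  \int[P]_w F (U w) = \sum_(0 <= k < n) fine (P (U @^-1` [set k])) * F k.
Proof.
move=> mU F0; pose K := \sum_(0 <= k < n) `|F k|.
have FK k : `|F k| <= K.
  have [nk|kn] := leqP n k; first by rewrite F0// normr0 sumr_ge0.
  by rewrite /K (big_rem k)/= ?mem_index_iota// lerDl sumr_ge0.
have /cvg_lim <- // := Rintegral_discrete measurableT FK mU.
apply: lim_near_cst => //; exists n => // m /= nm.
rewrite -[LHS]/(\sum_(0 <= _ < m) _) (big_cat_nat (leq0n _) nm)/=.
rewrite [X in _ + X]big_nat_cond [X in _ + X]big1 ?addr0.
  by apply: eq_bigr => k _; rewrite setTI mulrC.
by move=> k /andP[/andP[nk _] _]; rewrite F0 ?mul0r.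
Qed.

Lemma sum_law_le1 U n : measurable_fun setT U ->
  \sum_(0 <= k < n) fine (P (U @^-1` [set k])) <= 1.
Proof.
move=> mU; have /= H := @Rintegral_finite_support (fun k => (k < n)%:R) n U mU.
rewrite (eq_big_nat _ _ (F2 := fun k => fine (P (U @^-1` [set k])) * (k < n)%:R)).
  rewrite -H; last by move=> k; rewrite leqNgt => /negbTE ->.
  have := @bounded_Rintegral_le _ _ _ P setT (fun w => (U w < n)%:R) 1 measurableT.
  rewrite probability_setT mulr1 => H1; apply: le_trans (ler_norm _) (H1 _ _).
    exact: (nat_fun_comp (fun k => (k < n)%:R)).
  by move=> w _; case: (_ < _)%N; rewrite ?normr1 ?normr0.
by move=> k /andP[_ ->]; rewrite mulr1.
Qed.

Lemma law_at_0 U : measurable_fun setT U ->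
  fine (P (U @^-1` [set 0%N])) = 1 - fine (P [set w | (1 <= U w)%N]).
Proof.
move=> mU; have mU0 : measurable (U @^-1` [set 0%N]) by exact: nat_fun_preimage.
have -> : [set w | (1 <= U w)%N] = ~` (U @^-1` [set 0%N]).
  by apply/seteqP; split=> w /=; [case: (U w)|case: (U w)].
rewrite probability_setC// fineB//; first by rewrite /= opprB addrC subrK.
exact: fin_num_measure.
Qed.

End DiscreteVariables.

(** * Absolutely convergent pairings *)

Section Pairing.
Context {R : realType}.
Implicit Types (c e f : nat -> R).

(** The functional through which every function of the coefficients is
    expressed: the normalizer, the density series and the tail function are its
    values at the weights [q ^+ j], [exp (- b_j x)] and [q ^+ j * exp (- b_j x)]. *)
Definition pairing c e : R := limn (series (fun j => c j * e j)).

Definition abs_summable c := cvgn (series (fun j => `|c j|)).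

Definition abs_sum c : R := limn (series (fun j => `|c j|)).

Lemma partial_abs_sum_le c n : abs_summable c ->
  \sum_(0 <= j < n) `|c j| <= abs_sum c.
Proof.
move=> sc; apply: (@nondecreasing_cvgn_le _ (series (fun j => `|c j|))) => //.
exact: nondecreasing_series.
Qed.

Lemma abs_sum_ge0 c : abs_summable c -> 0 <= abs_sum c.
Proof. by move=> /(partial_abs_sum_le 0); rewrite big_nil. Qed.

Lemma pairing_normed_cvg c e B : abs_summable c -> (forall j, `|e j| <= B) ->
  cvgn (series (fun j => `|c j * e j|)).
Proof.
move=> sc eB; have B0 : 0 <= B by exact: le_trans (eB 0%N).
apply: (@series_le_cvg _ _ (B *: (fun j => `|c j|))) => //.
- by move=> j; rewrite mulr_ge0.
- by move=> j; rewrite normrM mulrC ler_wpM2r.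
- exact: is_cvg_seriesZ.
Qed.

Lemma pairing_cvg c e B : abs_summable c -> (forall j, `|e j| <= B) ->
  cvgn (series (fun j => c j * e j)).
Proof. by move=> sc eB; apply: normed_cvg; exact: pairing_normed_cvg eB. Qed.

Lemma pairing_le c e B : abs_summable c -> (forall j, `|e j| <= B) ->
  `|pairing c e| <= B * abs_sum c.
Proof.
move=> sc eB; have B0 : 0 <= B by exact: le_trans (eB 0%N).
apply: le_trans (lim_series_norm (pairing_normed_cvg sc eB)) _.
rewrite -[leRHS](lim_seriesZ B sc); apply: lim_series_le.
- exact: pairing_normed_cvg eB.
- exact: is_cvg_seriesZ.
- by move=> j /=; rewrite normrM mulrC ler_wpM2r.
Qed.

Lemma pairingB c e f B : abs_summable c ->
  (forall j, `|e j| <= B) -> (forall j, `|f j| <= B) ->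
  pairing c (fun j => e j - f j) = pairing c e - pairing c f.
Proof.
move=> sc eB fB; rewrite -lim_seriesB//; [|exact: pairing_cvg eB|exact: pairing_cvg fB].
by congr (limn (series _)); apply/funext => j; rewrite mulrBr.
Qed.

Lemma pairingZ c e B k : abs_summable c -> (forall j, `|e j| <= B) ->
  pairing c (fun j => k * e j) = k * pairing c e.
Proof.
move=> sc eB; rewrite -[RHS](lim_seriesZ k (pairing_cvg sc eB)).
by congr (limn (series _)); apply/funext => j; rewrite /= mulrCA.
Qed.

(** Dominated convergence for the pairing, uniformly over all weights bounded
    by 1: only finitely many coordinates matter up to [eps]. *)
Lemma pairing_tail c eps : abs_summable c -> 0 < eps ->
  exists N, forall e, (forall j, `|e j| <= 1) ->
    `|pairing c e| <= eps + \sum_(0 <= j < N) `|c j| * `|e j|.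
Proof.
move=> sc eps0.
have /cvgrPdist_le/(_ _ eps0)[N _ /(_ N (leqnn N)) HN] :
  series (fun j => `|c j|) @ \oo --> abs_sum c by exact: sc.
exists N => e e1.
have cne := pairing_normed_cvg sc e1.
apply: le_trans (lim_series_norm cne) _.
apply: limr_le => //.
apply: nearW => n.
have tail m : \sum_(N <= j < m) `|c j * e j| <= eps.
  have [Nm|/ltnW mN] := leqP N m; last by rewrite big_geq// ltW.
  apply: (@le_trans _ _ (\sum_(N <= j < m) `|c j|)).
    by apply: ler_sum => j _; rewrite normrM ler_piMr.
  rewrite -(sub_series_geq (fun j => `|c j|) Nm).
  rewrite (le_trans _ (le_trans (ler_norm _) HN))// lerD2r.
  exact: partial_abs_sum_le.
rewrite -[leLHS]/(\sum_(0 <= j < n) `|c j * e j|); have [Nn|/ltnW nN] := leqP N n.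
  rewrite (big_cat_nat (leq0n _) Nn)//= addrC lerD//.
  by apply: ler_sum => j _; rewrite normrM.
rewrite (eq_bigr (fun j => `|c j| * `|e j|)); last by move=> j _; rewrite normrM.
rewrite (big_cat_nat (leq0n _) nN)//= addrCA lerDl addr_ge0 ?(ltW eps0)//.
by apply: sumr_ge0 => j _; rewrite mulr_ge0.
Qed.

End Pairing.

(** * The coefficients *)

Section Coefficients.
Context {R : realType}.
Variables (q p1 : R) (p c : nat -> R).
Hypotheses (q_gt0 : 0 < q) (q_lt1 : q < 1) (p1_gt0 : 0 < p1).
Hypothesis p_ge0 : forall k, 0 <= p k.
Hypothesis p0E : p 0%N = 1 - p1.
Hypothesis p_sum : forall n, \sum_(0 <= k < n) p k <= 1.
Hypothesis Hc : coef_recurrence q p p1 c.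

Lemma sum_convolution (u v e : nat -> R) n :
  \sum_(0 <= i < n) e i * (\sum_(0 <= k < i.+1) u k * v (i - k)%N) =
  \sum_(0 <= k < n) u k * (\sum_(0 <= j < n - k) v j * e (j + k)%N).
Proof.
elim: n => [|n IHn]; first by rewrite !big_nil.
rewrite big_nat_recr//= IHn [RHS]big_nat_recr//= subSnn big_nat1 add0n.
rewrite [in LHS]big_nat_recr//= subnn mulrDr [in LHS]addrA.
rewrite mulr_sumr -big_split/= mulrA (mulrC (e n)) -mulrA (mulrC (e n)); congr (_ + _).
apply: eq_big_nat => k /andP[_ kn].
by rewrite subSn ?(ltnW kn)// big_nat_recr//= subnK ?(ltnW kn)// mulrDr; ring.
Qed.

(** Cleared of denominators, the recurrence is a convolution with the law [p]
    itself, the term [k = 0] being supplied by [p 0 = 1 - p1]. *)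
Lemma coef_convolution j :
  \sum_(0 <= k < j.+1) p k * (c (j - k)%N * q ^+ (j - k)) =
  c j * q ^+ j - p1 * c j.
Proof.
have [c0 cS] := Hc; rewrite big_nat_recl// subn0 p0E.
case: j => [|j]; first by rewrite big_nil c0 expr0; ring.
have q0 : q != 0 by rewrite gt_eqF.
set s := \sum_(_ <= k < _) _.
suff -> : s = p1 * (c j.+1 * q ^+ j.+1) - p1 * c j.+1 by ring.
have -> : s = q ^+ j.+1 * \sum_(1 <= k < j.+2) q ^- k * p k * c (j.+1 - k)%N.
  rewrite big_add1/= mulr_sumr; apply: eq_big_nat => k /andP[_ kj].
  rewrite -[in q ^+ j.+1](subnKC (kj : (k.+1 <= j.+1)%N)) exprD.
  have := expf_neq0 k.+1 q0; move: (q ^+ k.+1) => x x0.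
  by field.
have qj : q ^+ j.+1 < 1 by rewrite exprn_ilt1// ltW.
have qj0 : 0 < q ^+ j.+1 by rewrite exprn_gt0.
rewrite [in RHS]cS//; set S := \sum_(_ <= _ < _) _.
move: (q ^+ j.+1) qj qj0 => x x1 x0; field.
by rewrite gt_eqF//= gt_eqF//= lt_eqF// subr_lt0.
Qed.

Let B n x := \sum_(0 <= j < n) `|c j| * x ^+ j.

Let B_ge0 n x : 0 <= x -> 0 <= B n x.
Proof. by move=> x0; apply: sumr_ge0 => j _; rewrite mulr_ge0// exprn_ge0. Qed.

Let B_contract n x : 0 <= x <= 1 -> B n x <= 1 + x / (1 - q) * B n (q * x).
Proof.
move=> /andP[x0 x1]; pose p' k := if k is 0%N then 0 else p k.
have p'0 k : 0 <= p' k by case: k => [|k] /=.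
have cj j : `|c j| * (1 - q ^+ j) * p1 <=
    \sum_(0 <= k < j.+1) p' k * (`|c (j - k)%N| * q ^+ (j - k)).
  have := coef_convolution j; rewrite big_nat_recl//= subn0 p0E => H.
  have {}H : c j * (1 - q ^+ j) * p1 =
      - \sum_(0 <= k < j) p k.+1 * (c (j - k.+1)%N * q ^+ (j - k.+1)).
    set s := \sum_(0 <= _ < _) _ in H *.
    have -> : s = c j * q ^+ j - p1 * c j - (1 - p1) * (c j * q ^+ j).
      by rewrite -H; ring.
    by ring.
  have -> : `|c j| * (1 - q ^+ j) * p1 = `|c j * (1 - q ^+ j) * p1|.
    rewrite !normrM (gtr0_norm p1_gt0) [`|1 - _|]ger0_norm//.
    by rewrite subr_ge0 exprn_ile1// ltW.
  rewrite H normrN big_nat_recl//= mul0r add0r.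
  apply: le_trans (ler_norm_sum _ _ _) _; apply: ler_sum => k _.
  by rewrite !normrM ger0_norm// (ger0_norm (exprn_ge0 _ (ltW q_gt0))).
have bound j : (0 < j)%N -> `|c j| * x ^+ j <= x / (1 - q) / p1 *
    \sum_(0 <= k < j.+1) p' k * (`|c (j - k)%N| * (q * x) ^+ (j - k)).
  move=> j0; set S := \sum_(_ <= _ < _) _.
  rewrite [leRHS](_ : _ = x * S / ((1 - q) * p1)); last first.
    by field; rewrite !gt_eqF// subr_gt0.
  rewrite ler_pdivlMr; last by rewrite mulr_gt0// subr_gt0.
  apply: (@le_trans _ _ (`|c j| * (1 - q ^+ j) * p1 * x ^+ j)).
    rewrite [leLHS](_ : _ = (1 - q) * (`|c j| * x ^+ j * p1)); last by ring.
    rewrite [leRHS](_ : _ = (1 - q ^+ j) * (`|c j| * x ^+ j * p1)); last by ring.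
    rewrite ler_wpM2r ?mulr_ge0 ?exprn_ge0// ?(ltW p1_gt0)// lerD2l lerN2.
    by rewrite -[leRHS]expr1 ler_wiXn2l// ltW.
  apply: le_trans (ler_wpM2r (exprn_ge0 j x0) (cj j)) _.
  rewrite /S mulr_suml mulr_sumr; apply: ler_sum_nat => k /andP[_ kj].
  rewrite exprMn; case: k kj => [|k] kj; first by rewrite /= !mul0r mulr0.
  have -> : x ^+ j = x ^+ (j - k.+1) * x * x ^+ k.
    by rewrite -mulrA -exprS -exprD subnK.
  set A := _ * x; rewrite [leRHS](_ : _ = p' k.+1 * `|c (j - k.+1)%N| *
     q ^+ (j - k.+1) * A); last by rewrite /A; ring.
  rewrite [leLHS](_ : _ = p' k.+1 * `|c (j - k.+1)%N| *
     q ^+ (j - k.+1) * A * x ^+ k); last by rewrite /A; ring.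
  by rewrite ler_piMr ?exprn_ile1// !mulr_ge0 ?exprn_ge0// ltW.
case: n => [|n]; first by rewrite /B !big_nil mulr0 addr0.
rewrite {1}/B big_nat_recl//= Hc.1 normr1 expr0 mulr1 lerD2l.
apply: (@le_trans _ _ (x / (1 - q) / p1 * \sum_(0 <= j < n.+1)
    1 * \sum_(0 <= k < j.+1) p' k * (`|c (j - k)%N| * (q * x) ^+ (j - k)))).
  have K0 : 0 <= x / (1 - q) / p1 by rewrite !divr_ge0// ?subr_ge0 ltW.
  rewrite mulr_sumr [leRHS]big_nat_recl//= big_nat1 mul0r !mulr0 add0r.
  by apply: ler_sum => j _; rewrite mul1r bound.
rewrite (sum_convolution p' (fun j => `|c j| * (q * x) ^+ j) (fun=> 1)).
rewrite -mulrA ler_wpM2l ?divr_ge0 ?subr_ge0 ?(ltW q_lt1)//.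
rewrite ler_pdivrMl// big_nat_recl//= mul0r add0r.
apply: (@le_trans _ _ (\sum_(0 <= k < n) p k.+1 * B n.+1 (q * x))).
  apply: ler_sum => k _; rewrite ler_wpM2l//.
  rewrite [leRHS](big_cat_nat (leq0n _) (leq_subr k.+1 n.+1))//=.
  rewrite -[leLHS]addr0 lerD//.
    by apply: ler_sum => j _; rewrite mulr1.
  by apply: sumr_ge0 => j _; rewrite mulr_ge0// exprn_ge0// mulr_ge0// ltW.
rewrite -mulr_suml ler_wpM2r//; first by rewrite B_ge0// mulr_ge0// ltW.
have := p_sum n.+1; rewrite big_nat_recl// p0E; lra.
Qed.

(** With [B x] a partial sum of [\sum_j `|c j| * x ^+ j], the recurrence gives
    [B x <= 1 + x / (1 - q) * B (q * x)].  For small [x] the factor is at most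
    1/2 and, [B] being monotone, the inequality bounds [B x] by 2; finitely many
    applications carry the bound from there up to [x = 1]. *)
Lemma coef_abs_summable : abs_summable c.
Proof.
have q1 m : 0 <= q ^+ m <= 1 by rewrite exprn_ge0 ?exprn_ile1// ltW.
have mono n m : B n (q ^+ m.+1) <= B n (q ^+ m).
  apply: ler_sum => j _; rewrite ler_wpM2l// lerXn2r ?nnegrE ?exprn_ge0 ?(ltW q_gt0)//.
  by rewrite exprS ler_piMl ?exprn_ge0 ?(ltW q_lt1)// ltW.
have [m Hm] : exists m, q ^+ m / (1 - q) <= 2^-1.
  have : geometric 1 q @ \oo --> (0 : R).
    by apply: cvg_geometric; rewrite ger0_norm// ltW.
  move/cvgrPdist_le => /(_ (2^-1 * (1 - q))) H.
  have /H : 0 < 2^-1 * (1 - q) by rewrite mulr_gt0// subr_gt0.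
  move=> [m _ /(_ m (leqnn m))]; rewrite /= sub0r normrN mul1r ger0_norm.
    by move=> ?; exists m; rewrite ler_pdivrMr// subr_gt0.
  by rewrite exprn_ge0// ltW.
have bound k : (k <= m)%N -> exists M, forall n, B n (q ^+ (m - k)) <= M.
  elim: k => [_|k IHk km].
    exists 2 => n; rewrite subn0.
    have := B_contract n (q1 m); rewrite -exprS => H.
    have B0 : 0 <= B n (q ^+ m.+1) by apply: B_ge0; case/andP: (q1 m.+1).
    have := ler_wpM2r B0 Hm; have := mono n m; lra.
  have [M HM] := IHk (ltnW km).
  exists (1 + q ^+ (m - k.+1) / (1 - q) * M) => n.
  apply: le_trans (B_contract n (q1 _)) _; rewrite lerD2l ler_wpM2l//.
    by rewrite divr_ge0 ?exprn_ge0 ?subr_ge0// ltW.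
  by rewrite -exprS subnSK.
have [M HM] := bound m (leqnn m).
apply: nondecreasing_is_cvgn; first exact: nondecreasing_series.
exists M => _ [n _ <-]; apply: le_trans (HM n).
by rewrite subnn expr0; apply: ler_sum => j _; rewrite expr1n mulr1.
Qed.

End Coefficients.

(** * The recurrence as an identity of pairings *)

Section WeightedRecurrence.
Context {d : measure_display} {T : measurableType d} {R : realType}.
Variables (P : probability T R) (q : R) (Z : T -> nat) (c : nat -> R).
Hypotheses (q_gt0 : 0 < q) (q_lt1 : q < 1) (mZ : measurable_fun setT Z).
Let p1 := fine (P [set w | (1 <= Z w)%N]).
Hypothesis p1_gt0 : 0 < p1.
Hypothesis Hc : coef_recurrence q (fun k => fine (P [set w | Z w = k])) p1 c.

Lemma coef_summable : abs_summable c.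
Proof.
apply: (coef_abs_summable q_gt0 q_lt1 p1_gt0 _ _ _ Hc).
- by move=> k; rewrite fine_ge0.
- exact: law_at_0.
- by move=> n; exact: sum_law_le1.
Qed.

Lemma expq_le1 (m : nat) : `|q ^+ m| <= 1.
Proof. by rewrite ger0_norm ?exprn_ile1 ?exprn_ge0// ltW. Qed.

Lemma bounded_qweight (e : nat -> R) B k : (forall j, `|e j| <= B) ->
  forall j, `|q ^+ j * e (j + k)%N| <= B.
Proof.
by move=> eB j; rewrite normrM (le_trans _ (eB (j + k)%N))// ler_piMl ?expq_le1.
Qed.

(** The convolution form of the recurrence, summed against arbitrary bounded
    weights [e]: constant weights give the value of the density at 0, powers of
    [q] the sign of the normalizer, exponentials the equation of the tail
    function.  Truncated at [i < n], the sum over [i] of a convolution is the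
    expectation of a truncated shifted sum; bounded convergence removes the
    truncation. *)
Lemma pairing_recurrence (e : nat -> R) B : (forall j, `|e j| <= B) ->
  p1 * pairing c e = pairing c (fun j => q ^+ j * e j) -
    \int[P]_w pairing c (fun j => q ^+ j * e (j + Z w)%N).
Proof.
move=> eB; have sc := coef_summable.
have B0 : 0 <= B := le_trans (normr_ge0 _) (eB 0%N).
pose F n k := \sum_(0 <= j < n - k) c j * (q ^+ j * e (j + k)%N).
pose G k := pairing c (fun j => q ^+ j * e (j + k)%N).
have FK n k : `|F n k| <= abs_sum c * B.
  apply: le_trans (ler_norm_sum _ _ _) _.
  apply: le_trans (ler_wpM2r B0 (partial_abs_sum_le (n - k) sc)).
  rewrite mulr_suml; apply: ler_sum => j _.
  by rewrite normrM ler_wpM2l// bounded_qweight.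
have FG k : F n k @[n --> \oo] --> G k.
  have : cvgn (series (fun j => c j * (q ^+ j * e (j + k)%N))).
    exact: pairing_cvg (bounded_qweight k eB).
  by rewrite -(cvg_centern k).
have lim1 : \int[P]_w F n (Z w) @[n --> \oo] --> \int[P]_w G (Z w).
  apply: (@bounded_convergence _ _ _ P setT (fun n w => F n (Z w)) _ (abs_sum c * B)) => //.
  - by move=> n; exact: nat_fun_comp.
  - exact: nat_fun_comp.
have FE n : \int[P]_w F n (Z w) =
    \sum_(0 <= i < n) (c i * (q ^+ i * e i) - p1 * (c i * e i)).
  rewrite (@Rintegral_finite_support _ _ _ P (F n) n Z mZ); last first.
    by move=> k nk; rewrite /F (eqP (nk : (n - k == 0)%N)) big_geq.
  under [LHS]eq_bigr => k _ do (rewrite /F; under eq_bigr do rewrite mulrA).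
  rewrite -(sum_convolution _ (fun j => c j * q ^+ j) e).
  apply: eq_bigr => i _.
  rewrite (coef_convolution q_gt0 q_lt1 p1_gt0 _ Hc); first by ring.
  exact: law_at_0.
have lim2 : \int[P]_w F n (Z w) @[n --> \oo] -->
    pairing c (fun j => q ^+ j * e j) - p1 * pairing c e.
  rewrite (funext FE); under eq_fun do rewrite sumrB -mulr_sumr.
  apply: cvgB.
    apply: (@pairing_cvg _ c (fun j => q ^+ j * e j) B) => // j.
    by have := bounded_qweight 0 eB j; rewrite addn0.
  by apply: cvgMr; exact: (@pairing_cvg _ c e B).
have := cvg_unique _ lim1 lim2; rewrite -/G => H.
have -> : \int[P]_w G (Z w) = pairing c (fun j => q ^+ j * e j) - p1 * pairing c e.
  by apply: H.
by ring.
Qed.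

End WeightedRecurrence.

Section NormalizerPositive.
Context {d : measure_display} {T : measurableType d} {R : realType}.
Variables (P : probability T R) (q : R) (Z : T -> nat) (c : nat -> R).
Hypotheses (q_gt0 : 0 < q) (q_lt1 : q < 1) (mZ : measurable_fun setT Z).
Let p1 := fine (P [set w | (1 <= Z w)%N]).
Hypothesis p1_gt0 : 0 < p1.
Hypothesis Hc : coef_recurrence q (fun k => fine (P [set w | Z w = k])) p1 c.

Lemma generating_function_lt1 n : (0 < n)%N -> \int[P]_w (q ^+ (n * Z w)) < 1.
Proof.
move=> n0; pose B := [set w | (1 <= Z w)%N].
have mB : measurable B by exact: (@nat_fun_preimage _ _ Z [set k | (1 <= k)%N]).
have mf : measurable_fun setT (fun w => q ^+ (n * Z w)).
  exact: (@nat_fun_comp _ _ _ Z (fun k => q ^+ (n * k))).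
have f1 w : `|q ^+ (n * Z w)| <= 1 by exact: expq_le1.
have int_if D : measurable D -> P.-integrable D (EFin \o (fun w => q ^+ (n * Z w))).
  by move=> mD; apply: (@bounded_integrable _ _ _ P D _ 1).
rewrite -(setvU B) Rintegral_setU//; last 3 first.
- exact: measurableC.
- by apply: int_if; rewrite setvU.
- by apply/disj_setPS => w [].
apply: (@le_lt_trans _ _ (1 * fine (P (~` B)) + q * p1)).
  apply: lerD; apply: le_trans (ler_norm _) _; apply: bounded_Rintegral_le => //.
    exact: measurableC.
  move=> w /= Zw; rewrite ger0_norm ?exprn_ge0 ?(ltW q_gt0)//.
  by rewrite -[leRHS]expr1 ler_wiXn2l ?(ltW q_gt0) ?(ltW q_lt1)// muln_gt0 n0.
rewrite probability_setC// fineB ?fin_num_measure// -/p1 mul1r.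
have : 0 < (1 - q) * p1 by rewrite mulr_gt0 ?subr_gt0.
by rewrite /=; lra.
Qed.

(** The generating function [C x = \sum_j c_j x ^ j] satisfies
    [p1 * C (q ^ n) = C (q ^ n.+1) * (1 - E (q ^ (n * Z)))] and tends to 1 at 0,
    so that positivity passes from a large [n] down to [n = 1]. *)
Lemma normalizer_gt0 : 0 < pairing c (fun j => q ^+ j).
Proof.
have sc := coef_summable q_gt0 q_lt1 mZ p1_gt0 Hc.
pose C n := pairing c (fun j => q ^+ (n * j)).
have step n : (0 < n)%N -> 0 < C n.+1 -> 0 < C n.
  move=> n0 Cn; have := pairing_recurrence q_gt0 q_lt1 mZ p1_gt0 Hc
    (fun j => expq_le1 q_gt0 q_lt1 (n * j)).
  rewrite (_ : pairing c (fun j => q ^+ j * _) = C n.+1); last first.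
    by congr (pairing c _); apply/funext => j; rewrite -exprD mulSn.
  under eq_Rintegral => w _.
    under [X in pairing _ X]funext => j do
      rewrite mulnDr exprD mulrA -exprD -mulSn mulrC.
    rewrite (pairingZ _ sc (fun j => expq_le1 q_gt0 q_lt1 (n.+1 * j))) -/(C n.+1).
    over.
  rewrite RintegralZr//; last first.
    apply: (@bounded_integrable _ _ _ P setT _ 1) => //.
      exact: (@nat_fun_comp _ _ _ Z (fun k => q ^+ (n * k))).
    by move=> w _; exact: expq_le1.
  move=> H; rewrite -(pmulr_rgt0 _ p1_gt0) -/(C n) in H *.
  rewrite H -[X in X - _]mul1r -mulrBl mulr_gt0// subr_gt0.
  exact: generating_function_lt1.
have [n n0 Cn] : exists2 n, (0 < n)%N & 0 < C n.
  have : geometric (abs_sum c) q @ \oo --> (0 : R).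
    by apply: cvg_geometric; rewrite ger0_norm// ltW.
  move/cvgrPdist_lt => /(_ 1 ltr01)[n _ /(_ n.+1 (leqnSn n))].
  rewrite /= sub0r normrN ger0_norm; last first.
    by rewrite mulr_ge0 ?abs_sum_ge0 ?exprn_ge0// ltW.
  move=> small; exists n.+1 => //.
  pose e j : R := q ^+ (n.+1 * j) - (j == 0%N)%:R.
  have le1 j : `|(j == 0%N)%:R : R| <= 1 by case: (_ == _); rewrite ?normr1 ?normr0.
  have eq j : `|e j| <= q ^+ n.+1.
    rewrite /e; case: j => [|j]; first by rewrite muln0 subrr normr0 exprn_ge0// ltW.
    rewrite subr0 ger0_norm ?exprn_ge0 ?(ltW q_gt0)// ler_wiXn2l ?(ltW q_gt0) ?(ltW q_lt1)//.
    by rewrite leq_pmulr.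
  have := pairing_le sc eq.
  rewrite /e (pairingB sc (fun j => expq_le1 q_gt0 q_lt1 _) le1) -/(C n.+1).
  have -> : pairing c (fun j => (j == 0%N)%:R) = 1.
    apply: lim_near_cst => //; exists 1%N => // m /= m1.
    rewrite -[LHS]/(\sum_(0 <= _ < m) _) big_ltn// big_nat_cond big1.
      by rewrite addr0 mulr1 Hc.1.
    by case=> // j _; rewrite mulr0.
  rewrite ler_norml => /andP[+ _]; rewrite mulrC; lra.
elim: n n0 Cn => // -[//|n] IHn _ Cn.
  by move: Cn; rewrite /C; under [X in pairing _ X]funext => j do rewrite mul1n.
by apply: IHn => //; exact: step.
Qed.

End NormalizerPositive.

(** * The tail function and the density *)

Section ExpRemainders.
Context {R : realType}.

Lemma expR_remainder1 (t : R) : 0 <= t ->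
  `|expR (- t) - 1| <= t /\ `|expR (- t) - 1| <= 1.
Proof.
move=> t0; have e1 : expR (- t) <= 1 by rewrite -expR0 ler_expR oppr_le0.
have := expR_ge1Dx (- t); have := expR_ge0 (- t).
by rewrite ler0_norm ?subr_le0//; split; lra.
Qed.

Lemma expR_remainder2 (t : R) : 0 <= t ->
  `|expR (- t) - 1 + t| <= t * t /\ `|expR (- t) - 1 + t| <= t.
Proof.
move=> t0; have e1 : expR (- t) <= 1 by rewrite -expR0 ler_expR oppr_le0.
have H1 := expR_ge1Dx (- t).
have H2 : expR (- t) * (1 + t) <= 1.
  have E : 1 = expR (- t) * expR t by rewrite -expRD addNr expR0.
  by rewrite [leRHS]E ler_wpM2l ?expR_ge0 ?expR_ge1Dx.
rewrite ger0_norm; last by lra.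
split; last by lra.
by nra.
Qed.

End ExpRemainders.

Section TailFunction.
Context {R : realType}.
Variables (q a : R) (c : nat -> R).
Hypotheses (q_gt0 : 0 < q) (q_lt1 : q < 1) (a_gt0 : 0 < a).

Definition decay (x : R) (j : nat) : R := expR (- (a * q ^- j * x)).

Definition tail_series (x : R) : R :=
  (pairing c (fun j => q ^+ j))^-1 * pairing c (fun j => q ^+ j * decay x j).

Definition density_series (x : R) : R :=
  a / pairing c (fun j => q ^+ j) * pairing c (decay x).

(** The candidates for [P (x < I)] and for minus its derivative, on the whole
    line: 1 and 0 on the negative half-line, in agreement with the values of
    the series at 0. *)
Definition tail_fun (x : R) : R := tail_series (Num.max x 0).
Definition density_fun (x : R) : R := density_series (Num.max x 0).

Let D := pairing c (fun j => q ^+ j).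
Hypotheses (sc : abs_summable c) (D_gt0 : 0 < D).
Hypothesis sum0 : pairing c (fun=> 1) = 0.

Let rate_gt0 j : 0 < a * q ^- j.
Proof. by rewrite mulr_gt0// invr_gt0 exprn_gt0. Qed.

Lemma decay_le1 x j : 0 <= x -> `|decay x j| <= 1.
Proof.
move=> x0; rewrite ger0_norm ?expR_ge0// -expR0 ler_expR oppr_le0.
by rewrite mulr_ge0// ltW.
Qed.

Lemma decayD x y j : decay (x + y) j = decay x j * decay y j.
Proof. by rewrite /decay -expRD; congr expR; ring. Qed.

Lemma decay_shift x j k : decay x (j + k) = decay (q ^- k * x) j.
Proof. by rewrite /decay exprD invfM; congr expR; ring. Qed.

Let qdecay_le1 x j : 0 <= x -> `|q ^+ j * decay x j| <= 1.
Proof.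
by move=> x0; rewrite normrM mulr_ile1 ?decay_le1// (expq_le1 q_gt0 q_lt1).
Qed.

Lemma tail_series0 : tail_series 0 = 1.
Proof.
rewrite /tail_series (_ : (fun j => _) = (fun j => q ^+ j)) ?mulVf ?gt_eqF//.
by apply/funext => j; rewrite /decay mulr0 oppr0 expR0 mulr1.
Qed.

Lemma density_series0 : density_series 0 = 0.
Proof.
rewrite /density_series (_ : decay 0 = (fun=> 1)) ?sum0 ?mulr0//.
by apply/funext => j; rewrite /decay mulr0 oppr0 expR0.
Qed.

Lemma tail_fun_le0 x : x <= 0 -> tail_fun x = 1.
Proof. by move=> x0; rewrite /tail_fun max_r// tail_series0. Qed.

Lemma density_fun_le0 x : x <= 0 -> density_fun x = 0.
Proof. by move=> x0; rewrite /density_fun max_r// density_series0. Qed.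

Lemma tail_fun_ge0E x : 0 <= x -> tail_fun x = tail_series x.
Proof. by move=> x0; rewrite /tail_fun max_l. Qed.

Lemma density_fun_ge0E x : 0 <= x -> density_fun x = density_series x.
Proof. by move=> x0; rewrite /density_fun max_l. Qed.

Definition tail_bound := D^-1 * abs_sum c.

Lemma tail_fun_bound x : `|tail_fun x| <= tail_bound.
Proof.
rewrite /tail_fun /tail_series normrM gtr0_norm ?invr_gt0//.
rewrite ler_wpM2l ?invr_ge0 ?(ltW D_gt0)// -[leRHS]mul1r.
by apply: pairing_le => // j; rewrite qdecay_le1// le_max lexx orbT.
Qed.

Lemma tail_fun_decay x : 0 <= x -> `|tail_fun x| <= tail_bound * expR (- (a * x)).
Proof.
move=> x0; rewrite tail_fun_ge0E// /tail_series normrM gtr0_norm ?invr_gt0//.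
rewrite -mulrA ler_wpM2l ?invr_ge0 ?(ltW D_gt0)// mulrC.
apply: pairing_le => // j; rewrite ger0_norm ?mulr_ge0 ?expR_ge0 ?exprn_ge0 ?(ltW q_gt0)//.
rewrite -[leRHS]mul1r; apply: ler_pM; rewrite ?expR_ge0 ?exprn_ge0 ?(ltW q_gt0)//.
  by rewrite exprn_ile1// ltW.
rewrite ler_expR lerN2 ler_wpM2r// ler_peMr ?(ltW a_gt0)//.
by rewrite invf_ge1 ?exprn_gt0// exprn_ile1// ltW.
Qed.

(** The weights meant here are the remainders of the Taylor expansions of
    [decay]: small with [h] in each coordinate, but not uniformly in [j], since
    the rates [a * q ^- j] grow.  Their bound by 1 takes care of the large [j]. *)
Lemma pairing_modulus eps : 0 < eps -> exists2 delta, 0 < delta &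
  forall h w, h <= delta -> (forall j, `|w j| <= 1) ->
    (forall j, `|w j| <= a * q ^- j * h) -> `|pairing c w| <= eps.
Proof.
move=> eps0; have eps20 : 0 < eps / 2 by rewrite divr_gt0.
have [N HN] := pairing_tail sc eps20.
pose K := \sum_(0 <= j < N) `|c j| * (a * q ^- j).
have K0 : 0 <= K by apply: sumr_ge0 => j _; rewrite mulr_ge0// ltW.
exists (eps / 2 / (K + 1)); first by rewrite divr_gt0// ltr_wpDl.
move=> h w hd w1 wh; apply: le_trans (HN w w1) _.
rewrite [leRHS](splitr eps) lerD2l.
apply: (@le_trans _ _ (K * h)).
  rewrite mulr_suml; apply: ler_sum => j _.
  by rewrite -mulrA ler_wpM2l.
apply: le_trans (ler_wpM2l K0 hd) _.
rewrite mulrA ler_pdivrMr ?ltr_wpDl// [leRHS]mulrC ler_wpM2r ?(ltW eps20)//.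
by rewrite lerDl.
Qed.

Lemma density_series_uniform eps : 0 < eps -> exists2 delta, 0 < delta &
  forall x h, 0 <= x -> 0 <= h <= delta ->
    `|density_series (x + h) - density_series x| <= eps.
Proof.
move=> eps0; have aD : 0 < a / D by exact: divr_gt0.
have [delta delta0 Hd] := pairing_modulus (divr_gt0 eps0 aD).
exists delta => // x h x0 /andP[h0 hd]; rewrite /density_series -/D -mulrBr.
rewrite -(pairingB sc (fun j => decay_le1 j (addr_ge0 x0 h0)) (fun j => decay_le1 j x0)).
rewrite normrM (gtr0_norm aD) mulrC -ler_pdivlMr//.
have E j : decay (x + h) j - decay x j = decay x j * (decay h j - 1).
  by rewrite decayD mulrBr mulr1.
have [B1 B2] : (forall j, `|decay h j - 1| <= a * q ^- j * h) /\
    (forall j, `|decay h j - 1| <= 1).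
  by split => j; have [] := expR_remainder1 (mulr_ge0 (ltW (rate_gt0 j)) h0).
apply: (Hd h) => // j; rewrite E normrM.
  by rewrite -[leRHS]mulr1 ler_pM// decay_le1.
by rewrite -[leRHS]mul1r ler_pM// decay_le1.
Qed.

(** The summand [j] of the remainder is [a * h * c_j] times a weight bounded by
    both 1 and [a * q ^- j * h]: the factor [q ^+ j] of the tail series pays for
    the derivative of [decay], which is of order [q ^- j]. *)
Lemma tail_series_expansion eps : 0 < eps -> exists2 delta, 0 < delta &
  forall x h, 0 <= x -> 0 < h <= delta ->
    `|tail_series (x + h) - tail_series x + h * density_series x| <= h * eps.
Proof.
move=> eps0; have aD : 0 < a / D by exact: divr_gt0.
have [delta delta0 Hd] := pairing_modulus (divr_gt0 eps0 aD).
exists delta => // x h x0 /andP[h0 hd].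
pose t j := a * q ^- j * h.
have t0 j : 0 < t j by rewrite mulr_gt0.
pose r j := (decay h j - 1 + t j) / t j.
have r1 j : `|r j| <= 1.
  rewrite normrM [`|(t j)^-1|]gtr0_norm ?invr_gt0// ler_pdivrMr// mul1r.
  by have [] := expR_remainder2 (ltW (t0 j)).
have r2 j : `|r j| <= t j.
  rewrite normrM [`|(t j)^-1|]gtr0_norm ?invr_gt0// ler_pdivrMr//.
  by have [] := expR_remainder2 (ltW (t0 j)).
have E j : q ^+ j * decay (x + h) j - q ^+ j * decay x j =
    a * h * (decay x j * r j - decay x j).
  rewrite decayD /r /t; field; rewrite ?gt_eqF ?exprn_gt0//.
have xh0 : 0 <= x + h by rewrite addr_ge0// ltW.
have rx1 j : `|decay x j * r j| <= 1 by rewrite normrM mulr_ile1// decay_le1.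
have rd1 j : `|decay x j * r j - decay x j| <= 2.
  apply: le_trans (ler_normB _ _) _; have := rx1 j; have := decay_le1 j x0; lra.
rewrite /tail_series /density_series -/D -mulrBr.
rewrite -(pairingB sc (fun j => qdecay_le1 j xh0) (fun j => qdecay_le1 j x0)).
rewrite (_ : (fun j => _) = fun j => a * h * (decay x j * r j - decay x j)); last first.
  exact/funext.
rewrite (pairingZ _ sc rd1) (pairingB sc rx1 (fun j => decay_le1 j x0)).
rewrite [X in `|X|](_ : _ = h * (a / D * pairing c (fun j => decay x j * r j))); last by ring.
rewrite normrM (gtr0_norm h0) ler_wpM2l ?(ltW h0)//.
rewrite normrM (gtr0_norm aD) mulrC -ler_pdivlMr//.
apply: (Hd h) => // j; rewrite normrM.
by rewrite -[leRHS]mul1r ler_pM// decay_le1.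
Qed.

Lemma density_fun_uniform eps : 0 < eps -> exists2 delta, 0 < delta &
  forall x h, 0 <= h <= delta -> `|density_fun (x + h) - density_fun x| <= eps.
Proof.
move=> eps0; have [delta d0 Hd] := density_series_uniform eps0.
exists delta => // x h /andP[h0 hd].
have [x0|x0] := leP 0 x.
  by rewrite !density_fun_ge0E ?addr_ge0//; apply: Hd => //; rewrite h0.
rewrite [density_fun x]density_fun_le0 ?(ltW x0)//.
have [xh0|xh0] := leP (x + h) 0.
  by rewrite density_fun_le0// subrr normr0 ltW.
rewrite density_fun_ge0E ?(ltW xh0)// -density_series0 -[x + h]add0r.
by apply: Hd => //; rewrite (ltW xh0); lra.
Qed.

Lemma tail_fun_expansion eps : 0 < eps -> exists2 delta, 0 < delta &
  forall x h, 0 < h <= delta ->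
    `|tail_fun (x + h) - tail_fun x + h * density_fun x| <= h * eps.
Proof.
move=> eps0; have [delta d0 Hd] := tail_series_expansion eps0.
exists delta => // x h /andP[h0 hd].
have [x0|x0] := leP 0 x.
  rewrite !tail_fun_ge0E ?addr_ge0 ?(ltW h0)// density_fun_ge0E//.
  by apply: Hd => //; rewrite h0.
rewrite density_fun_le0 ?(ltW x0)// mulr0 addr0 [tail_fun x]tail_fun_le0 ?(ltW x0)//.
have [xh0|xh0] := leP (x + h) 0.
  by rewrite tail_fun_le0// subrr normr0 mulr_ge0// ltW.
have /(Hd 0 _ (lexx _)) : 0 < x + h <= delta by rewrite xh0; lra.
rewrite density_series0 mulr0 addr0 add0r tail_series0 -tail_fun_ge0E ?(ltW xh0)//.
move/le_trans; apply; rewrite ler_wpM2r ?(ltW eps0)//; lra.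
Qed.

Lemma tail_fun_derive (x : R) : is_derive x (1 : R) tail_fun (- density_fun x).
Proof.
suff lim : (fun h : R => h^-1 *: ((tail_fun \o shift x) (h *: (1 : R)) - tail_fun x))
    @ 0^' --> - density_fun x.
  by apply: DeriveDef; [apply/cvg_ex; exists (- density_fun x)|exact: cvg_lim lim].
apply/cvgrPdist_le => eps eps0; have eps20 : 0 < eps / 2 by rewrite divr_gt0.
have [d1 d10 H1] := tail_fun_expansion eps20.
have [d2 d20 H2] := density_fun_uniform eps20.
near=> h.
have h0 : h != 0 by near: h; exact: nbhs_dnbhs_neq.
have hd : `|h| <= Num.min d1 d2.
  near: h; apply: dnbhs0_le.
  by rewrite lt_min d10.
move: hd; rewrite le_min => /andP[hd1 hd2].
rewrite /= [h *: _]mulr1 -[_ *: _]/(_ * _) (addrC h x).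
rewrite -normrN opprB opprK.
have -> : h^-1 * (tail_fun (x + h) - tail_fun x) + density_fun x =
    h^-1 * (tail_fun (x + h) - tail_fun x + h * density_fun x) by field.
have [hpos|hneg|h00] := ltgtP 0 h; last by rewrite -h00 eqxx in h0.
  rewrite normrM gtr0_norm ?invr_gt0// ler_pdivrMl//.
  apply: le_trans (H1 x h _) _; first by rewrite hpos -(gtr0_norm hpos).
  by rewrite ler_wpM2l ?(ltW hpos)// ler_pdivrMr// ler_peMr ?(ltW eps0)// ler1n.
have hN : 0 < - h by rewrite oppr_gt0.
rewrite ltr0_norm// in hd1 hd2.
have := H1 (x + h) (- h); rewrite hN hd1 addrK => /(_ isT) A1.
have := H2 (x + h) (- h); rewrite (ltW hN) hd2 addrK => /(_ isT) A2.
rewrite [X in `|X|](_ : _ = (- h)^-1 *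
  ((tail_fun x - tail_fun (x + h) - h * density_fun (x + h)) -
   h * (density_fun x - density_fun (x + h)))); last by field.
rewrite normrM gtr0_norm ?invr_gt0// ler_pdivrMl//.
apply: le_trans (ler_normB _ _) _.
rewrite [leRHS](_ : _ = - h * (eps / 2) + - h * (eps / 2)); last by field.
rewrite lerD//.
  by rewrite mulNr in A1.
by rewrite normrM ltr0_norm// ler_wpM2l// ltW.
Unshelve. all: by end_near. Qed.

Lemma tail_fun_continuous : continuous tail_fun.
Proof.
move=> x; apply: differentiable_continuous; apply/derivable1_diffP.
by case: (tail_fun_derive x).
Qed.

Lemma density_fun_continuous : continuous density_fun.
Proof.
move=> x; apply/cvgrPdist_le => eps eps0.
have [delta d0 Hd] := density_fun_uniform eps0.
near=> y.
have yd : `|y - x| <= delta.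
  by rewrite distrC; near: y; apply: cvgr_dist_le.
have [xy|yx] := leP x y.
  rewrite distrC; have := Hd x (y - x); rewrite (addrC x) subrK; apply.
  by rewrite subr_ge0 xy -[X in X <= _]ger0_norm// subr_ge0.
have := Hd y (x - y); rewrite (addrC y) subrK; apply.
by rewrite subr_ge0 ltW//= -[X in X <= _]gtr0_norm ?subr_gt0// distrC.
Unshelve. all: by end_near. Qed.

End TailFunction.

Section FunctionalEquation.
Context {d : measure_display} {T : measurableType d} {R : realType}.
Variables (P : probability T R) (q lam : R) (Z : T -> nat) (c : nat -> R).
Hypotheses (q_gt0 : 0 < q) (q_lt1 : q < 1) (mZ : measurable_fun setT Z).
Let p1 := fine (P [set w | (1 <= Z w)%N]).
Hypotheses (p1_gt0 : 0 < p1) (lam_gt0 : 0 < lam).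
Hypothesis Hc : coef_recurrence q (fun k => fine (P [set w | Z w = k])) p1 c.
Let a := lam * p1.

(** The density vanishes at 0; without this the tail function would have a
    corner there. *)
Lemma sum_coef_eq0 : pairing c (fun=> 1) = 0.
Proof.
have e1 j : `|(fun=> 1 : R) (j : nat)| <= 1 by rewrite normr1.
have := pairing_recurrence q_gt0 q_lt1 mZ p1_gt0 Hc e1.
rewrite Rintegral_cstT subrr => /eqP.
by rewrite mulf_eq0 gt_eqF//= => /eqP.
Qed.

(** As the density is minus the derivative of the tail function, this says that
    the tail function is harmonic for the process that drifts at speed [-1] and
    is multiplied by [q ^- Z] at rate [lam].  It is [pairing_recurrence] for the
    weights [decay], which turn the shift of the index by [Z] into the scaling of
    the argument by [q ^- Z]. *)
Lemma tail_fun_backward x :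
  \int[P]_w tail_fun q a c (q ^- Z w * x) =
  tail_fun q a c x - density_fun q a c x / lam.
Proof.
have sc := coef_summable q_gt0 q_lt1 mZ p1_gt0 Hc.
have D0 := normalizer_gt0 q_gt0 q_lt1 mZ p1_gt0 Hc.
have a0 : 0 < a by exact: mulr_gt0.
have qk k : 0 < q ^- k by rewrite invr_gt0 exprn_gt0.
have [x0|x0] := leP x 0.
  rewrite tail_fun_le0// density_fun_le0 ?mul0r ?subr0//; last exact: sum_coef_eq0.
  rewrite (@eq_Rintegral _ _ _ _ _ (cst 1)).
    by rewrite Rintegral_cstT.
  by move=> w _; rewrite tail_fun_le0// pmulr_rle0.
have e1 j : `|decay q a x j| <= 1 by apply: decay_le1 => //; exact: ltW.
rewrite tail_fun_ge0E ?(ltW x0)// density_fun_ge0E ?(ltW x0)//.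
rewrite /density_series (_ : _ / lam = (pairing c (fun j => q ^+ j))^-1 *
    (p1 * pairing c (decay q a x))); last first.
  by rewrite /a; field; rewrite !gt_eqF.
rewrite (pairing_recurrence q_gt0 q_lt1 mZ p1_gt0 Hc e1) mulrBr opprB addrC subrK.
pose G k := pairing c (fun j => q ^+ j * decay q a x (j + k)%N).
have iG : P.-integrable setT (EFin \o (fun w => G (Z w))).
  apply: (@bounded_integrable _ _ _ P setT _ (1 * abs_sum c)) => //.
    exact: (@nat_fun_comp _ _ _ Z G).
  move=> w _; apply: pairing_le => // j.
  exact: (bounded_qweight q_gt0 q_lt1).
have <- := RintegralZl (pairing c (fun j => q ^+ j))^-1 measurableT iG.
apply: eq_Rintegral => w _; rewrite tail_fun_ge0E; last first.
  by rewrite mulr_ge0 ?(ltW x0)// ltW.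
rewrite /tail_series /G; congr (_ * pairing c _); apply/funext => j.
by rewrite decay_shift.
Qed.

End FunctionalEquation.

(** * Cylinder events of sequences of integer variables *)

Section Cylinders.
Context {T : Type}.
Implicit Types (X : nat -> T -> nat) (s : seq nat).

Definition trajectory X (k : nat) (w : T) : seq nat := mkseq (fun i => X i w) k.

Definition cylinder X s : set T := trajectory X (size s) @^-1` [set s].

Lemma cylinderE X s :
  cylinder X s = \bigcap_(i in [set` iota 0 (size s)]) X i @^-1` [set nth 0%N s i].
Proof.
apply/seteqP; split=> w.
  move=> Xs i /=; rewrite mem_iota => /andP[_ si].
  by rewrite -[in RHS]Xs nth_mkseq.
move=> H; apply: (@eq_from_nth _ 0%N); rewrite size_mkseq// => i si.
by rewrite nth_mkseq//; apply: H; rewrite /= mem_iota.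
Qed.

Lemma cylinder_rcons X s j :
  cylinder X (rcons s j) = cylinder X s `&` X (size s) @^-1` [set j].
Proof.
apply/seteqP; split=> w; rewrite /cylinder /trajectory /preimage /= size_rcons mkseqS.
  by move/rcons_inj => [].
by move=> [-> ->].
Qed.

End Cylinders.

Section CylinderMeasurability.
Context {d : measure_display} {T : measurableType d}.
Implicit Types (X : nat -> T -> nat) (U V : T -> nat).

Lemma cylinder_measurable X s : (forall i, measurable_fun setT (X i)) ->
  measurable (cylinder X s).
Proof.
move=> mX; rewrite cylinderE; apply: bigcap_measurableType => i _.
exact: nat_fun_preimage.
Qed.

Lemma nat_fun_comp2 U V (g : nat -> nat -> nat) : measurable_fun setT U ->
  measurable_fun setT V -> measurable_fun setT (fun w => g (U w) (V w)).
Proof.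
move=> mU mV; apply: nat_fun_measurable => k.
have -> : (fun w => g (U w) (V w)) @^-1` [set k] =
    \bigcup_i (U @^-1` [set i] `&` V @^-1` [set j | g i j = k]).
  by apply/seteqP; split => [w <-|w [i _ [/= -> ->]]//]; exists (U w).
by apply: bigcup_measurable => i _; apply: measurableI; exact: nat_fun_preimage.
Qed.

Lemma nat_fun_index X U : (forall i, measurable_fun setT (X i)) ->
  measurable_fun setT U -> measurable_fun setT (fun w => X (U w) w).
Proof.
move=> mX mU; apply: nat_fun_measurable => k.
have -> : (fun w => X (U w) w) @^-1` [set k] =
    \bigcup_i (U @^-1` [set i] `&` X i @^-1` [set k]).
  by apply/seteqP; split => [w /= <-|w [i _ [/= <- ->]]//]; exists (U w).
by apply: bigcup_measurable => i _; apply: measurableI; exact: nat_fun_preimage.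
Qed.

Lemma partial_sum_measurable X n : (forall i, measurable_fun setT (X i)) ->
  measurable_fun setT (fun w => \sum_(i < n) X i w)%N.
Proof.
move=> mX; elim: n => [|n IHn].
  by under eq_fun do rewrite big_ord0; exact: measurable_cst.
by under eq_fun do rewrite big_ord_recr; exact: (nat_fun_comp2 addn IHn (mX n)).
Qed.

Lemma cylinder_indep (R : realType) (P : probability T R) X s j :
  mutually_independent P X ->
  fine (P (cylinder X (rcons s j))) =
  fine (P (cylinder X s)) * fine (P (X (size s) @^-1` [set j])).
Proof.
move=> indX; rewrite !cylinderE.
rewrite (indX _ (fun i => [set nth 0%N (rcons s j) i]) (iota_uniq _ _))//.
rewrite (indX _ (fun i => [set nth 0%N s i]) (iota_uniq _ _))//.
rewrite size_rcons -addn1 iotaD add0n big_cat/= big_seq1 nth_rcons ltnn eqxx.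
congr (_ * _); apply: eq_big_seq => i; rewrite mem_iota => /andP[_ si].
by rewrite nth_rcons si.
Qed.

End CylinderMeasurability.

(** * The subordinator on a time grid *)

Section Grid.
Context {d : measure_display} {T : measurableType d} {R : realType}.
Variables (P : probability T R) (lam : R) (N : R -> T -> nat).
Variables (Z : nat -> T -> nat) (S : R -> T -> nat).
Hypothesis HS : integer_valued_subordinator P lam N Z S.
Variable h : R.
Hypothesis h_gt0 : 0 < h.

Definition grid (i : nat) : R := i%:R * h.

Definition jump_count (i : nat) (w : T) : nat :=
  (N (grid i.+1) w - N (grid i) w)%N.

(** This variable determines the values of [S] up to the [k]-th grid point and
    has countably many values, so that conditioning on it amounts to summing over
    elementary events. *)
Definition past (k : nat) (w : T) : seq nat * seq nat :=
  (trajectory jump_count k w, trajectory Z (N (grid k) w) w).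

Definition past_event (k : nat) (mz : seq nat * seq nat) : set T :=
  past k @^-1` [set mz].

Let PN := ivs_poisson HS.

Lemma grid_ge0 i : 0 <= grid i.
Proof. by rewrite mulr_ge0// ltW. Qed.

Lemma grid_le i j : (i <= j)%N -> grid i <= grid j.
Proof. by move=> ij; rewrite ler_wpM2r ?(ltW h_gt0)// ler_nat. Qed.

Lemma grid0 : grid 0 = 0. Proof. by rewrite /grid mul0r. Qed.

Lemma gridS i : grid i.+1 = grid i + h.
Proof. by rewrite /grid -natr1 mulrDl mul1r. Qed.

Lemma jump_countK k w : N (grid k) w = sumn (trajectory jump_count k w).
Proof.
elim: k => [|k IHk]; first by rewrite grid0 (poisson_start PN).
rewrite /trajectory mkseqS sumn_rcons -IHk subnKC//.
by apply: (poisson_nondecreasing PN); rewrite ?grid_ge0 ?grid_le.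
Qed.

Lemma subordinator_measurable t : 0 <= t -> measurable_fun setT (S t).
Proof.
move=> t0; rewrite (_ : S t = fun w => \sum_(i < N t w) Z i w)%N; last first.
  by apply/funext => w; rewrite (ivs_compound HS).
apply: (@nat_fun_index _ _ (fun n w => \sum_(i < n) Z i w)%N).
  by move=> n; apply: partial_sum_measurable; exact: ivs_measurable HS.
exact: (poisson_measurable PN).
Qed.

Lemma jump_count_measurable i : measurable_fun setT (jump_count i).
Proof.
by apply: (nat_fun_comp2 subn); apply: (poisson_measurable PN); exact: grid_ge0.
Qed.

Lemma past_eventE k m z : size m = k -> sumn m = size z ->
  past_event k (m, z) = cylinder jump_count m `&` cylinder Z z.
Proof.
move=> mk mz; apply/seteqP; split=> w; rewrite /past_event /past /cylinder /preimage /=.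
  by move=> [Em Ez]; rewrite jump_countK Em mz in Ez; rewrite mk Em.
by rewrite mk => -[Em Ez]; rewrite jump_countK Em mz Ez.
Qed.

Lemma past_event_inhabited k m z w : past_event k (m, z) w ->
  size m = k /\ sumn m = size z.
Proof.
move=> [<- <-]; rewrite /trajectory !size_mkseq; split => //.
by rewrite [in RHS]jump_countK.
Qed.

Lemma past_event_measurable k mz : measurable (past_event k mz).
Proof.
case: mz => m z; have [[w Hw]|/set0P/negP/negPn/eqP ->//] :=
  pselect (past_event k (m, z) !=set0).
have [mk mzE] := past_event_inhabited Hw.
rewrite past_eventE//; apply: measurableI; apply: cylinder_measurable.
  exact: jump_count_measurable.
exact: ivs_measurable HS.
Qed.

(** Cylinders are measurable for every measurable structure that makes the
    coordinates measurable; taking the structure generated by [N], respectively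
    by [Z], places the two cylinders in the two independent systems. *)
Lemma cylinder_counts_sizes_indep m z :
  P (cylinder jump_count m `&` cylinder Z z) =
  (P (cylinder jump_count m) * P (cylinder Z z))%E.
Proof.
pose sig (I : Type) (D : set I) (X : I -> T -> nat) := g_sigma_algebraType
  (\bigcup_(i in D) preimage_set_system setT (X i) measurable).
have gen (I : Type) (D : set I) (X : I -> T -> nat) i : D i ->
    @measurable_fun _ _ (sig I D X) nat setT (X i).
  move=> Di _ B mB; apply: sub_sigma_algebra; exists i => //.
  by exists B.
apply: (ivs_independent_of_poisson HS).
  apply: (@cylinder_measurable _ (sig R [set t | 0 <= t] N) jump_count m) => i.
  by apply: (nat_fun_comp2 subn); apply: gen; exact: grid_ge0.
by apply: (@cylinder_measurable _ (sig nat setT Z) Z z) => i; exact: gen.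
Qed.

Lemma jump_count_independent : mutually_independent P jump_count.
Proof.
apply: (poisson_independent_increments PN (t := grid)); first by rewrite grid0.
by move=> i; exact: grid_le.
Qed.

(** A past event is a cylinder of jump counts intersected with a cylinder of
    jump sizes.  Prescribing the next count and the first unused size lengthens
    each cylinder by one coordinate. *)
Lemma past_next_law k m z j l : size m = k -> sumn m = size z ->
  fine (P (past_event k (m, z) `&` jump_count k @^-1` [set j] `&`
           Z (size z) @^-1` [set l])) =
  fine (P (past_event k (m, z))) * fine (P (jump_count k @^-1` [set j])) *
  fine (P (Z 0%N @^-1` [set l])).
Proof.
move=> mk mz; rewrite past_eventE//.
have -> : cylinder jump_count m `&` cylinder Z z `&` jump_count k @^-1` [set j] `&`
      Z (size z) @^-1` [set l] =
    cylinder jump_count (rcons m j) `&` cylinder Z (rcons z l).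
  rewrite !cylinder_rcons mk; apply/seteqP.
  by split=> w; [move=> [[[? ?] ?] ?]|move=> [[? ?] [? ?]]]; do !split.
have mJ s := cylinder_measurable s jump_count_measurable.
have mZ s := cylinder_measurable s (ivs_measurable HS).
rewrite !cylinder_counts_sizes_indep !fineM ?fin_num_measure//.
rewrite (cylinder_indep _ _ jump_count_independent) mk.
rewrite (cylinder_indep _ _ (ivs_independent HS)).
rewrite (ivs_identically_distributed HS (size z) (B := [set l]))//.
by rewrite mulrACA mulrA.
Qed.

Lemma past_count_law k m z j : size m = k -> sumn m = size z ->
  fine (P (past_event k (m, z) `&` jump_count k @^-1` [set j])) =
  fine (P (past_event k (m, z))) * fine (P (jump_count k @^-1` [set j])).
Proof.
move=> mk mz; rewrite past_eventE//.
have -> : cylinder jump_count m `&` cylinder Z z `&` jump_count k @^-1` [set j] =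
    cylinder jump_count (rcons m j) `&` cylinder Z z.
  by rewrite cylinder_rcons mk setIAC.
have mJ s := cylinder_measurable s jump_count_measurable.
have mZ s := cylinder_measurable s (ivs_measurable HS).
rewrite !cylinder_counts_sizes_indep !fineM ?fin_num_measure//.
by rewrite (cylinder_indep _ _ jump_count_independent) mk mulrAC.
Qed.

Lemma jump_count_law k j :
  fine (P (jump_count k @^-1` [set j])) = (lam * h) ^+ j / j`!%:R * expR (- (lam * h)).
Proof.
have := poisson_increments PN j (grid_ge0 k) (_ : grid k < grid k.+1).
rewrite gridS ltrDl => /(_ h_gt0) H.
rewrite [X in fine (P X)](_ : _ = [set w | (N (grid k + h) w - N (grid k) w)%N = j]).
  by rewrite H /= addrAC subrr add0r /poisson_pmf mulr_gt0// (ivs_intensity HS).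
by apply/seteqP; split=> w; rewrite /preimage/= /jump_count gridS.
Qed.

Lemma subordinator_no_jump k w : jump_count k w = 0%N ->
  S (grid k.+1) w = S (grid k) w.
Proof.
move=> E; rewrite !(ivs_compound HS) ?grid_ge0// /compound_sum.
by rewrite jump_countK /trajectory mkseqS sumn_rcons E addn0 -/(trajectory _ _ _) -jump_countK.
Qed.

Lemma subordinator_one_jump k w : jump_count k w = 1%N ->
  S (grid k.+1) w = (S (grid k) w + Z (N (grid k) w) w)%N.
Proof.
move=> E; rewrite !(ivs_compound HS) ?grid_ge0// /compound_sum.
rewrite [N (grid k.+1) w]jump_countK /trajectory mkseqS sumn_rcons E addn1.
by rewrite -/(trajectory _ _ _) -jump_countK big_ord_recr.
Qed.

Lemma subordinator_nondecreasing s t w : 0 <= s -> s <= t -> (S s w <= S t w)%N.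
Proof.
move=> s0 st; rewrite !(ivs_compound HS) ?(le_trans s0)// /compound_sum.
rewrite -!(big_mkord xpredT (fun i => Z i w)).
by rewrite [leqRHS](big_cat_nat (leq0n _) (poisson_nondecreasing PN w s0 st))/= leq_addr.
Qed.

End Grid.

Section OneStep.
Context {d : measure_display} {T : measurableType d} {R : realType}.
Variables (P : probability T R) (lam : R) (N : R -> T -> nat).
Variables (Z : nat -> T -> nat) (S : R -> T -> nat).
Hypothesis HS : integer_valued_subordinator P lam N Z S.
Variable h : R.
Hypothesis h_gt0 : 0 < h.

Local Notation grid := (grid h).
Local Notation jump_count := (jump_count N h).
Local Notation past := (past N Z h).
Local Notation past_event := (past_event N Z h).

Definition grid_increment (k : nat) (w : T) : nat :=
  (S (grid k.+1) w - S (grid k) w)%N.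

Lemma grid_increment_measurable k : measurable_fun setT (grid_increment k).
Proof.
by apply: (nat_fun_comp2 subn); apply: (subordinator_measurable HS); exact: grid_ge0.
Qed.

Lemma grid_subordinatorS k w : S (grid k.+1) w = (S (grid k) w + grid_increment k w)%N.
Proof.
by rewrite subnKC// (subordinator_nondecreasing HS)// ?grid_ge0 ?grid_le.
Qed.

Lemma past_code_measurable k : measurable_fun setT (fun w => pickle (past k w)).
Proof.
apply: nat_fun_measurable => n.
have [[w /= wn]|none] := pselect (exists w, pickle (past k w) = n).
  rewrite -wn (_ : _ @^-1` _ = past_event k (past k w)).
    exact: (past_event_measurable HS h_gt0).
  apply/seteqP; split=> v; last by rewrite /past_event /preimage/= => ->.
  exact: (pcan_inj pickleK).
rewrite (_ : _ @^-1` _ = set0)//; apply/seteqP; split=> // w wn.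
by apply: none; exists w.
Qed.

(** Coding the past by a natural number reduces the sum over past events to
    [Rintegral_partition]. *)
Lemma Rintegral_past_le k (f : T -> R) K delta : measurable_fun setT f ->
  (forall w, `|f w| <= K) -> 0 <= delta ->
  (forall mz, `|\int[P]_(w in past_event k mz) f w| <=
              delta * fine (P (past_event k mz))) ->
  `|\int[P]_w f w| <= delta.
Proof.
move=> mf fK delta0 Hf; pose U w := pickle (past k w).
have mU : measurable_fun setT U by exact: past_code_measurable.
have lim := @Rintegral_partition _ _ _ P setT f K U measurableT mf fK mU.
rewrite -(cvg_lim _ lim)// -lim_norm; last by apply/cvg_ex; exists (\int[P]_w f w).
apply: limr_le.
  by apply: is_cvg_norm; apply/cvg_ex; exists (\int[P]_w f w).
apply: nearW => n; rewrite -[X in `|X|]/(\sum_(0 <= _ < n) _).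
apply: le_trans (ler_norm_sum _ _ _) _.
apply: (@le_trans _ _ (\sum_(0 <= i < n) delta * fine (P (U @^-1` [set i])))).
  apply: ler_sum => i _; rewrite setTI.
  have [[w /= wi]|none] := pselect (exists w, U w = i).
    rewrite (_ : U @^-1` _ = past_event k (past k w))//.
    apply/seteqP; split=> v; last by rewrite /past_event /preimage/= -wi /U => ->.
    by rewrite /preimage/= -wi; exact: (pcan_inj pickleK).
  rewrite (_ : U @^-1` _ = set0); first by rewrite Rintegral_set0 normr0 mulr_ge0 ?fine_ge0.
  by apply/seteqP; split=> // w wi; apply: none; exists w.
by rewrite -mulr_sumr ler_piMr// sum_law_le1.
Qed.

(** The cell is split according to its number of jumps.  Without a jump the
    increment is 0; a single jump has the first unused size, which is distributed
    as [Z 0] given the past; and two jumps have a probability of second order. *)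
Lemma grid_increment_given_past k mz (F : nat -> R) K : (forall j, `|F j| <= K) ->
  `|\int[P]_(w in past_event k mz) F (grid_increment k w) -
    fine (P (past_event k mz)) *
      ((1 - lam * h) * F 0%N + lam * h * \int[P]_w F (Z 0%N w))| <=
  2 * K * (lam * h) ^+ 2 * fine (P (past_event k mz)).
Proof.
move=> FK; set A := past_event k mz; set u := lam * h.
have u0 : 0 <= u by rewrite mulr_ge0// ?ltW// (ivs_intensity HS).
have K0 : 0 <= K := le_trans (normr_ge0 _) (FK 0%N).
have [A0|/set0P[w0 Aw0]] := eqVneq A set0.
  by rewrite A0 Rintegral_set0 measure0 !mul0r !mulr0 subr0 normr0.
have mA : measurable A by exact: (past_event_measurable HS h_gt0).
case: mz @A Aw0 mA => m z A Aw0 mA.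
have [mk mzE] := past_event_inhabited HS h_gt0 Aw0.
pose J j := jump_count k @^-1` [set j].
have mJ j : measurable (J j).
  by apply: nat_fun_preimage; exact: (jump_count_measurable HS h_gt0).
pose f w := F (grid_increment k w).
have mf : measurable_fun setT f by exact: (nat_fun_comp F (grid_increment_measurable k)).
have fK w : `|f w| <= K by exact: FK.
have mA' : measurable (A `&` ~` J 0%N) by apply: measurableI => //; exact: measurableC.
have EJ : A `&` ~` J 0%N `&` J 1%N = A `&` J 1%N.
  apply/seteqP; split=> w [].
    by move=> [? _] ?; split.
  by move=> ? J1; split => //; split => //; rewrite /J/preimage/= J1.
have PA0 : fine (P (A `&` J 0%N)) = fine (P A) * expR (- u).
  by rewrite (past_count_law HS h_gt0)// (jump_count_law HS h_gt0) expr0 fact0 divr1 mul1r.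
have PA1 : fine (P (A `&` J 1%N)) = fine (P A) * (u * expR (- u)).
  by rewrite (past_count_law HS h_gt0)// (jump_count_law HS h_gt0) expr1 factS fact0 divr1.
set B := A `&` ~` J 0%N `&` ~` J 1%N.
have mB : measurable B by apply: measurableI => //; exact: measurableC.
have PB : fine (P B) = fine (P A) * (1 - expR (- u) - u * expR (- u)).
  have H1 := fine_measure_setIC P mA (mJ 0%N).
  have H2 := fine_measure_setIC P mA' (mJ 1%N).
  by rewrite EJ in H2; rewrite -/B in H2; move: H1; rewrite H2 PA0 PA1; lra.
have I0 : \int[P]_(w in A `&` J 0%N) f w = fine (P A) * expR (- u) * F 0%N.
  rewrite (@eq_Rintegral _ _ _ _ _ (cst (F 0%N))).
    by rewrite Rintegral_cst ?PA0 1?mulrC//; exact: measurableI.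
  move=> w; rewrite inE => -[_ Jw]; rewrite /f /grid_increment.
  by rewrite (subordinator_no_jump HS h_gt0 Jw) subnn.
have I1 : \int[P]_(w in A `&` J 1%N) f w =
    fine (P A) * (u * expR (- u)) * \int[P]_w F (Z 0%N w).
  rewrite (@eq_Rintegral _ _ _ _ _ (fun w => F (Z (size z) w))); last first.
    move=> w; rewrite inE => -[[Em Ez] Jw]; rewrite /f /grid_increment.
    rewrite (subordinator_one_jump HS h_gt0 Jw) addnC addnK; congr (F (Z _ w)).
    by rewrite -Ez size_mkseq.
  have mAJ : measurable (A `&` J 1%N) by exact: measurableI.
  have L1 := @Rintegral_discrete _ _ _ P _ F K _ mAJ FK (ivs_measurable HS (size z)).
  have L2 := @Rintegral_discrete _ _ _ P _ F K _ measurableT FK (ivs_measurable HS 0%N).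
  apply: (cvg_unique _ L1) => //.
  apply: cvg_trans (cvgM (cvg_cst (fine (P A) * (u * expR (- u)))) L2).
  apply: near_eq_cvg; apply: nearW => n.
  rewrite -[RHS]/(\sum_(0 <= _ < n) _) /= mulr_sumr; apply: eq_bigr => i _.
  rewrite (past_next_law HS h_gt0)// -PA1 (past_count_law HS h_gt0)//.
  by rewrite setTI; ring.
have I2 : `|\int[P]_(w in B) f w| <= K * fine (P B).
  by apply: bounded_Rintegral_le => // w _.
rewrite (Rintegral_setIC P mA (mJ 0%N) mf fK) (Rintegral_setIC P mA' (mJ 1%N) mf fK).
rewrite EJ -/B I0 I1.
move: I2; rewrite PB; set I := \int[P]_(w in B) f w; set G := \int[P]_w F (Z 0%N w) => I2.
have GK : `|G| <= K.
  have := @bounded_Rintegral_le _ _ _ P setT (fun w => F (Z 0%N w)) K measurableT.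
  rewrite probability_setT mulr1; apply => //.
  exact: (nat_fun_comp F (ivs_measurable HS 0%N)).
have PA : 0 <= fine (P A) by rewrite fine_ge0.
clearbody u.
move: (fine (P A)) PA I2 => pA pA0 I2.
have e1 : 1 - u <= expR (- u) by have := expR_ge1Dx (- u).
have e2 : expR (- u) <= 1 by rewrite -expR0 ler_expR oppr_le0.
move: (expR (- u)) e1 e2 I2 => e e1 e2 I2.
have eu : 0 <= e - 1 + u by lra.
rewrite [X in `|X|](_ : _ = pA * ((e - 1 + u) * F 0%N) + pA * (u * ((e - 1) * G)) + I);
  last by ring.
have T0 : `|pA * ((e - 1 + u) * F 0%N)| <= pA * ((e - 1 + u) * K).
  by rewrite !normrM (ger0_norm pA0) (ger0_norm eu) !ler_wpM2l.
have T1 : `|pA * (u * ((e - 1) * G))| <= pA * (u * ((1 - e) * K)).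
  rewrite !normrM (ger0_norm pA0) (ger0_norm u0) distrC (@ger0_norm _ (1 - e)) ?subr_ge0//.
  by rewrite !ler_wpM2l// subr_ge0.
apply: le_trans (ler_normD _ _) _; apply: le_trans (lerD (ler_normD _ _) (lexx _)) _.
apply: le_trans (lerD (lerD T0 T1) I2) _.
rewrite [leLHS](_ : _ = 2 * K * u * (1 - e) * pA); last by ring.
rewrite ler_wpM2r// expr2 [leRHS]mulrA ler_wpM2l ?mulr_ge0//; lra.
Qed.

End OneStep.

(** * The tail function is almost harmonic along the grid *)

Section Walk.
Context {d : measure_display} {T : measurableType d} {R : realType}.
Variables (P : probability T R) (lam q : R) (N : R -> T -> nat).
Variables (Z : nat -> T -> nat) (S : R -> T -> nat) (c : nat -> R).
Hypothesis HS : integer_valued_subordinator P lam N Z S.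
Hypotheses (q_gt0 : 0 < q) (q_lt1 : q < 1).
Let p1 := fine (P [set w | (1 <= Z 0%N w)%N]).
Hypothesis Hc : coef_recurrence q (fun k => fine (P [set w | Z 0%N w = k])) p1 c.
Let a := lam * p1.

Local Notation V := (tail_fun q a c).
Local Notation f := (density_fun q a c).

Let lam_gt0 := ivs_intensity HS.
Let mZ := ivs_measurable HS 0%N.

Lemma p1_gt0 : 0 < p1.
Proof.
rewrite fine_gt0// (ivs_nontrivial HS)/= (le_lt_trans (probability_le1 P _)) ?ltry//.
exact: (@nat_fun_preimage _ _ _ [set k | (1 <= k)%N] mZ).
Qed.

Let a_gt0 : 0 < a. Proof. by rewrite mulr_gt0// p1_gt0. Qed.
Let sc := coef_summable q_gt0 q_lt1 mZ p1_gt0 Hc.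
Let D_gt0 := normalizer_gt0 q_gt0 q_lt1 mZ p1_gt0 Hc.
Let sum0 := sum_coef_eq0 q_gt0 q_lt1 mZ p1_gt0 Hc.
Let K := tail_bound q c.
Let V_bound := tail_fun_bound q_gt0 q_lt1 a_gt0 sc D_gt0.

Section FixedMesh.
Variable h : R.
Hypothesis h_gt0 : 0 < h.
Local Notation grid := (grid h).

Definition riemann_sum (k : nat) (w : T) : R :=
  h * \sum_(0 <= i < k) q ^+ S (grid i) w.

(** The level that the remaining part of the integral, rescaled to a fresh copy,
    must exceed for the whole integral to exceed [x]. *)
Definition residual (x : R) (k : nat) (w : T) : R :=
  q ^- S (grid k) w * (x - riemann_sum k w).

Lemma residualS x k w : residual x k.+1 w =
  q ^- grid_increment S h k w * (residual x k w - h).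
Proof.
rewrite /residual /riemann_sum (grid_subordinatorS HS h_gt0) big_nat_recr//= exprD.
have := expf_neq0 (S (grid k) w) (lt0r_neq0 q_gt0).
have := expf_neq0 (grid_increment S h k w) (lt0r_neq0 q_gt0).
move: (q ^+ _) (q ^+ _) => y z y0 z0; field.
by rewrite y0 z0.
Qed.

Lemma riemann_sum_measurable k : measurable_fun setT (riemann_sum k).
Proof.
apply: measurable_funM => //; elim: k => [|k IHk].
  by under eq_fun do rewrite big_nil; exact: measurable_cst.
under eq_fun do rewrite big_nat_recr//=; apply: measurable_funD => //.
apply: (nat_fun_comp (fun j => q ^+ j)); apply: (subordinator_measurable HS).
exact: grid_ge0.
Qed.

Lemma residual_measurable x k : measurable_fun setT (residual x k).
Proof.
apply: measurable_funM.
  apply: (nat_fun_comp (fun j => q ^- j)); apply: (subordinator_measurable HS).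
  exact: grid_ge0.
by apply: measurable_funB => //; exact: riemann_sum_measurable.
Qed.

Lemma tail_residual_measurable x k : measurable_fun setT (fun w => V (residual x k w)).
Proof.
apply: measurableT_comp; last exact: residual_measurable.
apply: continuous_measurable_fun.
exact: (tail_fun_continuous q_gt0 q_lt1 a_gt0 sc D_gt0 sum0).
Qed.

Lemma past_determines k w w' i : past N Z h k w = past N Z h k w' -> (i <= k)%N ->
  S (grid i) w = S (grid i) w'.
Proof.
move=> [Ec Ez] ik.
have ENi : N (grid i) w = N (grid i) w'.
  rewrite !(jump_countK HS h_gt0); congr sumn.
  apply: (@eq_from_nth _ 0%N); rewrite !size_mkseq// => j ji.
  have := congr1 (nth 0%N ^~ j) Ec; rewrite !nth_mkseq//; exact: leq_trans ji ik.
rewrite !(ivs_compound HS) ?grid_ge0// /compound_sum ENi; apply: eq_bigr => j _.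
have := congr1 (nth 0%N ^~ j) Ez.
have Nk v : (N (grid i) v <= N (grid k) v)%N.
  by apply: (poisson_nondecreasing (ivs_poisson HS)); rewrite ?grid_ge0 ?grid_le.
by rewrite !nth_mkseq//; apply: leq_trans (Nk _); rewrite ?ENi.
Qed.

(** On a past event the residual has a known value [y], and the next one is
    [q ^- xi * (y - h)] with [xi] the grid increment.  To first order in [h] its
    expected tail value is [V (y - h) - h * f (y - h)] by [tail_fun_backward],
    which is [V y] by the Taylor expansion of [V] at [y - h]. *)
Lemma residual_step x k eps : 0 <= eps ->
  (forall y, `|V (y + h) - V y + h * f y| <= h * eps) ->
  `|\int[P]_w V (residual x k.+1 w) - \int[P]_w V (residual x k w)| <=
  h * eps + 2 * K * (lam * h) ^+ 2.
Proof.
move=> eps0 Hexp.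
have mV i := tail_residual_measurable x i.
have iV D i : measurable D -> P.-integrable D (EFin \o (fun w => V (residual x i w))).
  by move=> mD; apply: (@bounded_integrable _ _ _ P D _ K) => // w _; exact: V_bound.
have K0 : 0 <= K := le_trans (normr_ge0 _) (V_bound 0).
rewrite -RintegralB//; try exact: iV.
apply: (@Rintegral_past_le _ _ _ P lam N Z S HS h h_gt0 k _ (K + K)).
- exact: measurable_funB.
- by move=> w; apply: le_trans (ler_normB _ _) _; rewrite lerD// V_bound.
- apply: addr_ge0; first by rewrite mulr_ge0// ltW.
  by apply: mulr_ge0; [exact: mulr_ge0|exact: sqr_ge0].
move=> mz; set A := past_event N Z h k mz.
have mA : measurable A by exact: (past_event_measurable HS h_gt0).
rewrite RintegralB//; try exact: iV.
have [A0|/set0P[w0 Aw0]] := eqVneq A set0.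
  by rewrite A0 !Rintegral_set0 measure0 mulr0 subr0 normr0.
pose y := residual x k w0.
have Ey w : A w -> residual x k w = y.
  move=> Aw; have E i : (i <= k)%N -> S (grid i) w = S (grid i) w0.
    by apply: past_determines; rewrite -[LHS]/(past N Z h k w) Aw -Aw0.
  rewrite /y /residual /riemann_sum E//; congr (_ * (_ - _ * _)).
  by apply: eq_big_nat => i /andP[_ ik]; rewrite E// ltnW.
pose F j := V (q ^- j * (y - h)).
have := grid_increment_given_past HS h_gt0 k mz (F := F) (fun j => V_bound _).
rewrite -/A -/K; set IA := \int[P]_(w in A) _.
have -> : \int[P]_(w in A) V (residual x k.+1 w) = IA.
  by apply: eq_Rintegral => w; rewrite inE => Aw; rewrite residualS Ey.
have -> : \int[P]_(w in A) V (residual x k w) = V y * fine (P A).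
  by rewrite -(Rintegral_cst P mA (V y)); apply: eq_Rintegral => w; rewrite inE => /Ey ->.
have -> : \int[P]_w F (Z 0%N w) = V (y - h) - f (y - h) / lam.
  exact: (tail_fun_backward q_gt0 q_lt1 mZ p1_gt0 lam_gt0 Hc).
have -> : F 0%N = V (y - h) by rewrite /F expr0 invr1 mul1r.
have := Hexp (y - h); rewrite subrK.
have PA : 0 <= fine (P A) by rewrite fine_ge0.
move: (fine (P A)) PA => pA pA0 H1 H2.
rewrite [X in _ - pA * X](_ : _ = V (y - h) - h * f (y - h)) in H2; last first.
  by field; rewrite gt_eqF.
rewrite [X in `|X|](_ : _ = (IA - pA * (V (y - h) - h * f (y - h))) -
  pA * (V y - V (y - h) + h * f (y - h))); last by ring.
apply: le_trans (ler_normB _ _) _; rewrite mulrDl addrC lerD//.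
by rewrite normrM (ger0_norm pA0) mulrC ler_wpM2r.
Qed.

Lemma residual_expectation x k eps : 0 <= eps ->
  (forall y, `|V (y + h) - V y + h * f y| <= h * eps) ->
  `|\int[P]_w V (residual x k w) - V x| <=
  k%:R * (h * eps + 2 * K * (lam * h) ^+ 2).
Proof.
move=> eps0 Hexp; elim: k => [|k IHk].
  rewrite mul0r (@eq_Rintegral _ _ _ _ _ (cst (V x))).
    by rewrite Rintegral_cstT subrr normr0.
  move=> w _; rewrite /residual /riemann_sum big_nil mulr0 subr0 grid0.
  rewrite (ivs_compound HS)// /compound_sum (poisson_start (ivs_poisson HS)).
  by rewrite big_ord0 expr0 invr1 mul1r.
rewrite -natr1 mulrDl mul1r [leRHS]addrC.
rewrite -[X in `|X|](subrKA (\int[P]_w V (residual x k w))).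
by apply: le_trans (ler_normD _ _) _; rewrite lerD// residual_step.
Qed.

End FixedMesh.

(** The horizon [m] takes [m * n] steps of length [1 / n], and each of them costs
    [o (1 / n)]. *)
Lemma residual_expectation_small (x : R) (m : nat) eps : 0 < eps ->
  exists n0, forall n, (n0 <= n)%N -> (0 < n)%N ->
    `|\int[P]_w V (residual n%:R^-1 x (m * n) w) - V x| <= eps.
Proof.
move=> eps0; have K0 : 0 <= K := le_trans (normr_ge0 _) (V_bound 0).
pose eps' := eps / 2 / (m%:R + 1).
have m1 : 0 < m%:R + 1 :> R by rewrite ltr_wpDl.
have eps'0 : 0 < eps' by rewrite !divr_gt0.
have [delta delta0 Hd] :=
  tail_fun_expansion q_gt0 q_lt1 a_gt0 sc D_gt0 sum0 eps'0.
pose C := m%:R * (2 * K * lam ^+ 2).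
have C0 : 0 <= C.
  by apply: mulr_ge0 => //; apply: mulr_ge0; [exact: mulr_ge0|exact: sqr_ge0].
pose M := delta^-1 + C / (eps / 2).
have M0 : 0 <= M by rewrite addr_ge0 ?invr_ge0 ?divr_ge0 ?(ltW delta0) ?(ltW eps0).
exists (Num.bound M) => n nM n0.
have nR : 0 < n%:R :> R by rewrite ltr0n.
have Mn : M <= n%:R by rewrite (le_trans (ltW (archi_boundP M0)))// ler_nat.
have h0 : 0 < n%:R^-1 :> R by rewrite invr_gt0.
have hd : n%:R^-1 <= delta.
  rewrite -[leRHS]invrK lef_pV2 ?posrE ?invr_gt0// (le_trans _ Mn)// lerDl.
  by rewrite divr_ge0// ltW// divr_gt0.
have Cn : C * n%:R^-1 <= eps / 2.
  rewrite ler_pdivrMr// mulrC -ler_pdivrMr ?divr_gt0// (le_trans _ Mn)// lerDr.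
  by rewrite invr_ge0 ltW.
have Hexp y : `|V (y + n%:R^-1) - V y + n%:R^-1 * f y| <= n%:R^-1 * eps'.
  by apply: Hd; rewrite h0.
apply: le_trans (residual_expectation h0 x (m * n) (ltW eps'0) Hexp) _.
rewrite natrM [leLHS](_ : _ = m%:R * eps' + C * n%:R^-1); last first.
  by rewrite /C; field; rewrite gt_eqF.
rewrite [leRHS]splitr lerD// /eps' mulrCA ler_piMr ?(ltW (divr_gt0 eps0 _))//.
by rewrite ler_pdivrMr// mul1r lerDl.
Qed.

End Walk.

(** * Riemann sums of a nonincreasing function *)

Section MonotoneRiemann.
Context {R : realType}.
Variable g : R -> R.
Hypothesis g_ge0 : forall t, 0 <= t -> 0 <= g t.
Hypothesis g_le1 : forall t, 0 <= t -> g t <= 1.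
Hypothesis g_noninc : forall s t, 0 <= s -> s <= t -> g t <= g s.

Local Notation mu := (@lebesgue_measure R).

Lemma nonneg_line_measurable (D : set R) : measurable D -> D `<=` `[0, +oo[ ->
  measurable_fun D (fun t => (g t)%:E).
Proof.
move=> mD D0; suff : measurable_fun D g by move/measurable_EFinP.
apply: (eq_measurable_fun (fun t : R => g (Num.max t 0))).
  by move=> t /set_mem/D0 /=; rewrite in_itv/= andbT => t0; rewrite max_l.
apply: nonincreasing_measurable => // s t st; apply: g_noninc.
  by rewrite le_max lexx orbT.
by rewrite ge_max !le_max st lexx orbT.
Qed.

Variable h : R.
Hypothesis h_gt0 : 0 < h.

Definition grid_integral (k : nat) : \bar R :=
  (\int[mu]_(t in `[0%R, grid h k[) (g t)%:E)%E.

Let cell i := `[grid h i, grid h i.+1[%classic.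

Let cell_ge0 i : cell i `<=` `[0, +oo[.
Proof.
move=> t /=; rewrite !in_itv/= andbT => /andP[it _]; exact: le_trans (grid_ge0 h_gt0 i) it.
Qed.

Let cell_length i : mu (cell i) = h%:E.
Proof.
rewrite /cell lebesgue_measure_itv/= lte_fin gridS ltrDl h_gt0 -EFinB.
by rewrite addrAC subrr add0r.
Qed.

Let cell_bounds i :
  ((h * g (grid h i.+1))%:E <= \int[mu]_(t in cell i) (g t)%:E <= (h * g (grid h i))%:E)%E.
Proof.
have mc : measurable (cell i) by exact: measurable_itv.
have ge0 t : cell i t -> 0 <= t by move/cell_ge0; rewrite /= in_itv/= andbT.
apply/andP; split.
- rewrite mulrC EFinM -(cell_length i) -integral_cst//.
  apply: ge0_le_integral => //.
  + by move=> t _; rewrite lee_fin g_ge0// grid_ge0.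
  + exact: nonneg_line_measurable.
  + move=> t tc; rewrite lee_fin g_noninc ?ge0//.
    by move: tc; rewrite /cell/= in_itv/= => /andP[_ /ltW].
- rewrite [in leRHS]mulrC EFinM -(cell_length i) -integral_cst//.
  apply: ge0_le_integral => //.
  + by move=> t /ge0 t0; rewrite lee_fin g_ge0.
  + exact: nonneg_line_measurable.
  + move=> t; rewrite /cell/= in_itv/= => /andP[it _].
    by rewrite lee_fin g_noninc ?grid_ge0.
Qed.

Let grid_integralS k :
  grid_integral k.+1 = (grid_integral k + \int[mu]_(t in cell k) (g t)%:E)%E.
Proof.
have E : `[0, grid h k.+1[%classic = `[0, grid h k[ `|` cell k :> set R.
  by apply: (@itv_bndbnd_setU _ _ _ (BLeft (grid h k))); rewrite bnd_simp ?grid_ge0 ?grid_le.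
have sub : `[0, grid h k.+1[ `<=` (`[0, +oo[ : set R).
  by move=> t /=; rewrite !in_itv/= andbT => /andP[].
rewrite /grid_integral E ge0_integral_setU//.
- exact: measurable_itv.
- by rewrite -E; exact: nonneg_line_measurable.
- by move=> t; rewrite -E => /sub/=; rewrite in_itv/= andbT => t0; rewrite lee_fin g_ge0.
- apply/disj_setPS => t [/=]; rewrite /cell/= !in_itv/= => /andP[_ +] /andP[+ _].
  by move=> /lt_le_trans /[apply]; rewrite ltxx.
Qed.

Lemma grid_integral_bounds k :
  (grid_integral k <= (h * \sum_(0 <= i < k) g (grid h i))%:E <=
   grid_integral k + h%:E)%E.
Proof.
have lower : ((h * \sum_(0 <= i < k) g (grid h i.+1))%:E <= grid_integral k)%E.
  elim: k => [|k IHk].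
    by rewrite big_nil mulr0 /grid_integral grid0 set_itvco0 integral_set0.
  rewrite big_nat_recr//= mulrDr EFinD grid_integralS leeD//.
  by case/andP: (cell_bounds k).
have upper : (grid_integral k <= (h * \sum_(0 <= i < k) g (grid h i))%:E)%E.
  elim: k {lower} => [|k IHk].
    by rewrite big_nil mulr0 /grid_integral grid0 set_itvco0 integral_set0.
  rewrite big_nat_recr//= mulrDr EFinD grid_integralS leeD//.
  by case/andP: (cell_bounds k).
rewrite upper/=; apply: le_trans (leeD lower (lexx _)); rewrite -EFinD lee_fin.
rewrite -[X in _ <= _ + X]mulr1 -mulrDr ler_wpM2l ?(ltW h_gt0)//.
case: k {lower upper} => [|k]; first by rewrite !big_nil add0r ler01.
rewrite big_nat_recl//= [in leRHS]big_nat_recr//= [leLHS]addrC -[leRHS]addrA lerD2l.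
by rewrite -[leLHS]add0r lerD ?g_ge0 ?g_le1 ?grid_ge0.
Qed.

End MonotoneRiemann.

(** For a nonincreasing function with values in [[0, 1]] the Riemann sum over
    the horizon [m] exceeds the integral by at most one mesh.  Hence the horizon
    and the mesh can go to their limits together, also when the integral is
    infinite. *)
Lemma riemann_sum_cvg (R : realType) (g : R -> R) (mesh : nat -> nat) :
  (forall t, 0 <= t -> 0 <= g t) -> (forall t, 0 <= t -> g t <= 1) ->
  (forall s t, 0 <= s -> s <= t -> g t <= g s) ->
  (forall m, (m < mesh m)%N) ->
  ((mesh m)%:R^-1 *
    \sum_(0 <= i < m * mesh m) g (grid (mesh m)%:R^-1 i))%:E @[m --> \oo] -->
  (\int[@lebesgue_measure R]_(t in `[0%R, +oo[) (g t)%:E)%E.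
Proof.
move=> g0 g1 gni mesh_gt.
pose J (m : nat) : \bar R := (\int[@lebesgue_measure R]_(t in `[0%R, m%:R[) (g t)%:E)%E.
have sub (m : nat) : `[0, m%:R[ `<=` (`[0, +oo[ : set R).
  by move=> t /=; rewrite !in_itv/= andbT => /andP[].
have nn t : `[0, +oo[%classic t -> 0 <= g t by rewrite /= in_itv/= andbT; exact: g0.
have Jlim : J m @[m --> \oo] --> (\int[@lebesgue_measure R]_(t in `[0%R, +oo[) (g t)%:E)%E.
  rewrite (_ : `[0, +oo[%classic = \bigcup_(m : nat) `[0, m%:R[%classic :> set R); last first.
    apply/seteqP; split=> t /=; rewrite in_itv/= andbT => t0.
      exists (Num.bound t) => //=; rewrite in_itv/= t0 /=; exact: archi_boundP.
    by case: t0 => m _ /sub /=; rewrite in_itv/= andbT.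
  apply: ge0_nondecreasing_set_cvg_integral.
  - move=> m n mn; apply/subsetPset => t /=; rewrite !in_itv/= => /andP[-> /=].
    by move/lt_le_trans; apply; rewrite ler_nat.
  - by move=> m; exact: measurable_itv.
  - by move=> m; exact: nonneg_line_measurable.
  - by move=> m t /sub/nn; rewrite lee_fin.
have mesh0 : (mesh m)%:R^-1 @[m --> \oo] --> (0 : R).
  apply: (@squeeze_cvgr _ _ _ _ (fun=> 0) (@harmonic R)).
  - apply: nearW => m; rewrite invr_ge0 ler0n/= /harmonic/=.
    by rewrite lef_pV2 ?posrE ?ltr0n// ?ler_nat//; exact: leq_ltn_trans (mesh_gt m).
  - exact: cvg_cst.
  - exact: cvg_harmonic.
apply: (@squeeze_cvge _ _ _ _ J _ (fun m => J m + ((mesh m)%:R^-1)%:E)%E) => //.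
  apply: nearW => m; have n0 : 0 < (mesh m)%:R :> R.
    by rewrite ltr0n; exact: leq_ltn_trans (mesh_gt m).
  have := grid_integral_bounds g0 g1 gni (_ : 0 < (mesh m)%:R^-1) (m * mesh m).
  rewrite invr_gt0 => /(_ n0); rewrite /grid_integral.
  by rewrite [grid _ (m * _)%N](_ : _ = m%:R)// /grid natrM mulfK// gt_eqF.
rewrite -[X in _ --> X]adde0; apply: cvgeD => //; first by rewrite fin_num_adde_defl.
by apply: cvg_EFin => //; exact: nearW.
Qed.

(** * Laws and densities on the line *)

Section DensityOnRays.
Context {d : measure_display} {T : measurableType d} {R : realType}.
Variables (P : probability T R) (Y : T -> R) (f : R -> R).
Hypotheses (mY : measurable_fun setT Y) (mf : measurable_fun setT f).
Hypothesis f_ge0 : forall x, 0 <= f x.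
Local Notation mu := (@lebesgue_measure R).
Hypothesis ray : forall x,
  P [set w | x < Y w] = (\int[mu]_(y in `]x, +oo[) (f y)%:E)%E.

Let nu (A : set R) : \bar R := (\int[mu]_(x in A) (f x)%:E)%E.

Let nu0 : nu set0 = 0%E. Proof. exact: integral_set0. Qed.

Let nu_ge0 A : (0 <= nu A)%E.
Proof. by apply: integral_ge0 => x _; rewrite lee_fin. Qed.

Let nu_sigma_additive : semi_sigma_additive nu.
Proof.
move=> /= F mF tF mUF; apply: cvg_toP.
  apply: ereal_nondecreasing_is_cvgn => m n mn.
  by apply: lee_sum_nneg_natr => // k _ _; exact: nu_ge0.
rewrite /nu ge0_integral_bigcup//=.
- by apply/measurable_funTS; exact/measurable_EFinP.
- by move=> x _; rewrite lee_fin.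
Qed.

(** The open upper rays generate the Borel sets and are closed under
    intersection. *)
Lemma density_from_rays (A : set R) : measurable A ->
  P (Y @^-1` A) = (\int[mu]_(x in A) (f x)%:E)%E.
Proof.
move=> mA.
pose X : {mfun T >-> R} :=
  HB.pack Y (isMeasurableFun.Build _ _ _ _ Y mY).
pose m2 : {measure set R -> \bar R} :=
  HB.pack nu (isMeasure.Build _ _ _ nu nu0 nu_ge0 nu_sigma_additive).
have rayE x : Y @^-1` `]x, +oo[ = [set w | x < Y w].
  by apply/seteqP; split=> w; rewrite /preimage/= in_itv/= andbT.
rewrite -[LHS]/(distribution P X A) -[RHS]/(m2 A).
have mG : @measurable _ R = <<s @RGenOInfty.G R >> by exact: RGenOInfty.measurableE.
have GI : setI_closed (@RGenOInfty.G R).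
  move=> _ _ [x ->] [y ->]; exists (Num.max x y).
  apply/seteqP; split=> z /=; rewrite !in_itv/= !andbT gt_max.
    by move=> [-> ->].
  by move/andP.
pose g (n : nat) : set R := `](- n%:R), +oo[%classic.
have Gg n : @RGenOInfty.G R (g n) by exists (- n%:R).
have g_cover : \bigcup_n g n = setT.
  apply/seteqP; split=> // x _; exists (Num.bound `|x|) => //=.
  rewrite /g/= in_itv/= andbT ltrNl (le_lt_trans (ler_norm _))// normrN.
  exact: archi_boundP.
refine (measure_unique (@RGenOInfty.G R) g mG GI Gg g_cover (distribution P X) m2 _ _ A mA).
- by move=> _ [x ->]; rewrite -[RHS]ray -rayE.
- move=> n; apply: le_lt_trans (probability_le1 (distribution P X) _) _.
    exact: measurable_itv.
  by rewrite -[1%E]/(1%:E) ltry.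
Qed.

End DensityOnRays.

(** * The law of the exponential functional *)

Section Law.
Context {d : measure_display} {T : measurableType d} {R : realType}.
Variables (P : probability T R) (lam q : R) (N : R -> T -> nat).
Variables (Z : nat -> T -> nat) (S : R -> T -> nat) (c : nat -> R).
Hypothesis HS : integer_valued_subordinator P lam N Z S.
Hypotheses (q_gt0 : 0 < q) (q_lt1 : q < 1).
Let p1 := fine (P [set w | (1 <= Z 0%N w)%N]).
Hypothesis Hc : coef_recurrence q (fun k => fine (P [set w | Z 0%N w = k])) p1 c.
Let a := lam * p1.

Local Notation V := (tail_fun q a c).
Local Notation f := (density_fun q a c).
Local Notation I := (exponential_functional q S).

Let mZ := ivs_measurable HS 0%N.
Let a_gt0 : 0 < a.
Proof. by apply: mulr_gt0; [exact: ivs_intensity HS|exact: (p1_gt0 HS)]. Qed.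
Let sc := coef_summable q_gt0 q_lt1 mZ (p1_gt0 HS) Hc.
Let D_gt0 := normalizer_gt0 q_gt0 q_lt1 mZ (p1_gt0 HS) Hc.
Let sum0 := sum_coef_eq0 q_gt0 q_lt1 mZ (p1_gt0 HS) Hc.
Let K := tail_bound q c.
Let V_bound := tail_fun_bound q_gt0 q_lt1 a_gt0 sc D_gt0.
Let V_continuous := tail_fun_continuous q_gt0 q_lt1 a_gt0 sc D_gt0 sum0.
Let K_ge0 : 0 <= K := le_trans (normr_ge0 _) (V_bound 0).

Let Rsum (mesh : nat -> nat) m := riemann_sum q S (mesh m)%:R^-1 (m * mesh m).

Lemma riemann_sum_exp_functional_cvg mesh w : (forall m, (m < mesh m)%N) ->
  (Rsum mesh m w)%:E @[m --> \oo] --> I w.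
Proof.
move=> mesh_gt; apply: (riemann_sum_cvg (g := fun t => q ^+ S t w)) => //.
- by move=> t _; rewrite exprn_ge0// ltW.
- by move=> t _; rewrite exprn_ile1// ltW.
- move=> s t s0 st; rewrite ler_wiXn2l ?(ltW q_gt0) ?(ltW q_lt1)//.
  exact: (subordinator_nondecreasing HS).
Qed.

Lemma exp_functional_measurable : measurable_fun setT I.
Proof.
apply: (@emeasurable_fun_cvg _ _ _ setT (fun m w => (Rsum succn m w)%:E)).
  move=> m; have h0 : 0 < m.+1%:R^-1 :> R by rewrite invr_gt0 ltr0n.
  have mR := riemann_sum_measurable q HS h0 (m * m.+1).
  exact/measurable_EFinP.
by move=> w _; exact: riemann_sum_exp_functional_cvg.
Qed.

Lemma exp_functional_ge0 w : (0 <= I w)%E.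
Proof. by apply: integral_ge0 => t _; rewrite lee_fin exprn_ge0// ltW. Qed.

(** Where the integral is finite this pushes [q ^ S] at time [m] below a multiple
    of [1 / m], hence [S] to infinity. *)
Lemma riemann_sum_ge mesh m w : (0 < mesh m)%N ->
  m%:R * q ^+ S m%:R w <= Rsum mesh m w.
Proof.
move=> n0; set n := mesh m; have nR : 0 < n%:R :> R by rewrite ltr0n.
have h0 : 0 < n%:R^-1 :> R by rewrite invr_gt0.
have gm : grid n%:R^-1 (m * n) = m%:R :> R by rewrite /grid natrM mulfK// gt_eqF.
rewrite /Rsum /riemann_sum -/n ler_pdivlMl//.
apply: (@le_trans _ _ (\sum_(0 <= i < m * n) q ^+ S m%:R w)).
  rewrite big_const_nat subn0 iter_addr_0 -[leRHS]mulr_natr natrM.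
  by rewrite [leRHS](_ : _ = n%:R * (m%:R * q ^+ S m%:R w))//; ring.
apply: ler_sum_nat => i /andP[_ im].
rewrite ler_wiXn2l ?(ltW q_gt0) ?(ltW q_lt1)//.
by apply: (subordinator_nondecreasing HS); rewrite ?grid_ge0// -gm grid_le// ltnW.
Qed.

Lemma tail_fun_small eps y : 0 < eps -> K <= eps * (a * y) -> 0 <= y ->
  `|V y| <= eps.
Proof.
move=> eps0 Ky y0.
apply: le_trans (tail_fun_decay q_gt0 q_lt1 a_gt0 sc D_gt0 y0) _; rewrite -/K.
apply: le_trans (ler_wpM2r (expR_ge0 _) Ky) _.
rewrite -mulrA ler_piMr ?(ltW eps0)//.
have E : 1 = expR (a * y) * expR (- (a * y)) by rewrite -expRD subrr expR0.
rewrite [leRHS]E ler_wpM2r ?expR_ge0//.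
by have := expR_ge1Dx (a * y); lra.
Qed.

Let residual_m mesh x m := residual q S (mesh m)%:R^-1 x (m * mesh m).

Let residual_mE mesh x m w : (0 < mesh m)%N ->
  residual_m mesh x m w = q ^- S m%:R w * (x - Rsum mesh m w).
Proof.
move=> n0; rewrite /residual_m /residual [grid _ _](_ : _ = m%:R)//.
by rewrite /grid natrM mulfK// gt_eqF// ltr0n.
Qed.

Lemma tail_residual_above mesh x w : (forall m, (m < mesh m)%N) ->
  (x%:E < I w)%E -> V (residual_m mesh x m w) @[m --> \oo] --> (1 : R).
Proof.
move=> mesh_gt xI; apply: cvg_near_cst.
have := riemann_sum_exp_functional_cvg (w := w) mesh_gt.
move/(_ _ (open_nbhs_nbhs (conj (@open_ereal_gt_ereal _ x%:E) xI))) => [n _ Hn].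
exists n => // m /= nm; have /= := Hn m nm; rewrite lte_fin => xR.
rewrite (@tail_fun_le0 _ q a c D_gt0)// residual_mE; last exact: leq_ltn_trans (mesh_gt m).
by rewrite pmulr_rle0 ?invr_gt0 ?exprn_gt0// subr_le0 ltW.
Qed.

(** The difference [x - Rsum] stays above a positive constant while it is divided
    by [q ^ S], which is at most [x / m] at time [m]: the residual grows at least
    linearly in [m]. *)
Lemma tail_residual_below mesh x w : (forall m, (m < mesh m)%N) ->
  (I w < x%:E)%E -> V (residual_m mesh x m w) @[m --> \oo] --> (0 : R).
Proof.
move=> mesh_gt Ix.
have [r rI] : exists r, I w = r%:E.
  exists (fine (I w)); rewrite fineK// ge0_fin_numE ?exp_functional_ge0//.
  by rewrite (lt_trans Ix) ?ltry.
have r0 : 0 <= r by rewrite -lee_fin -rI exp_functional_ge0.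
have rx : r < x by rewrite -lte_fin -rI.
have x0 : 0 < x by exact: le_lt_trans rx.
pose e := (x - r) / 2; have e0 : 0 < e by rewrite divr_gt0// subr_gt0.
have Rr : Rsum mesh m w @[m --> \oo] --> r.
  have := riemann_sum_exp_functional_cvg (w := w) mesh_gt; rewrite rI.
  by move/fine_cvg.
apply/cvgrPdist_le => eps eps0; near=> m.
have m0 : (0 < m)%N by near: m; exact: nbhs_infty_gt.
have mesh0 : (0 < mesh m)%N by exact: leq_ltn_trans (mesh_gt m).
have Re : Rsum mesh m w <= x - e.
  have : `|r - Rsum mesh m w| <= e by near: m; move/cvgrPdist_le : Rr; exact.
  by rewrite ler_norml /e => /andP[+ _]; lra.
have mbig : K * x / (eps * a * e) <= m%:R by near: m; exact: nbhs_infty_ger.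
have mR : 0 < m%:R :> R by rewrite ltr0n.
have Sm : q ^+ S m%:R w <= x / m%:R.
  rewrite ler_pdivlMr// mulrC (le_trans (riemann_sum_ge w mesh0))//.
  by rewrite (le_trans Re)// gerBl ltW.
have Sm0 : 0 < q ^+ S m%:R w by rewrite exprn_gt0.
have yres : e * m%:R / x <= residual_m mesh x m w.
  rewrite residual_mE// (_ : e * m%:R / x = (m%:R / x) * e); last by ring.
  apply: ler_pM.
  - by rewrite divr_ge0// ltW.
  - exact: ltW.
  - by rewrite -invf_div lef_pV2// posrE divr_gt0.
  - lra.
have y0 : 0 <= residual_m mesh x m w.
  by apply: le_trans yres; apply: divr_ge0; [apply: mulr_ge0|]; exact: ltW.
rewrite sub0r normrN; move: yres y0; move: (residual_m _ _ _ _) => y yres y0.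
apply: tail_fun_small => //.
rewrite -(ler_pM2r x0); move: mbig yres.
rewrite ler_pdivrMr; last by do !apply: mulr_gt0 => //.
rewrite ler_pdivrMr// => mbig yres; apply: le_trans mbig _.
rewrite [leLHS](_ : _ = eps * a * (e * m%:R)); last by ring.
rewrite [leRHS](_ : _ = eps * a * (y * x)); last by ring.
by apply: ler_wpM2l yres; apply: mulr_ge0; exact: ltW.
Unshelve. all: by end_near. Qed.

Let above x := [set w | (x%:E < I w)%E].
Let level x := [set w | I w = x%:E].

Let above_measurable x : measurable (above x).
Proof.
rewrite -[above x]setTI.
by apply: emeasurable_fun_o_infty => //; exact: exp_functional_measurable.
Qed.

Let level_measurable x : measurable (level x).
Proof.
rewrite -[level x]setTI -[level x]/(I @^-1` [set x%:E]).
exact: exp_functional_measurable.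
Qed.

(** The expectation of [V] along the residuals stays close to [V x], and on
    [I <> x] the residual ends up on the side of the line where [V] is 1 or tends
    to the end where [V] is 0. *)
Lemma tail_fun_approx x :
  `|V x - fine (P (above x))| <= K * fine (P (level x)).
Proof.
(* one mesh per horizon, fine enough for the error to tend to 0 along the
   diagonal *)
have step m : exists n, (m < n)%N /\
    `|\int[P]_w V (residual q S n%:R^-1 x (m * n) w) - V x| <= m.+1%:R^-1.
  have e0 : 0 < m.+1%:R^-1 :> R by rewrite invr_gt0.
  have [n0 Hn] := residual_expectation_small HS q_gt0 q_lt1 Hc x m e0.
  exists (maxn n0 m.+1); split; first by rewrite leq_maxr.
  by apply: Hn; rewrite ?leq_maxl// (leq_trans _ (leq_maxr _ _)).
have [mesh Hmesh] := choice step.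
have mesh_gt m : (m < mesh m)%N by case: (Hmesh m).
pose W m w := V (residual_m mesh x m w).
have W_V : \int[P]_w W m w @[m --> \oo] --> V x.
  apply/cvgrPdist_le => eps eps0; near=> m; rewrite distrC.
  apply: le_trans (Hmesh m).2 _.
  have : `|0 - m.+1%:R^-1 : R| <= eps.
    near: m; have /cvgrPdist_le := @cvg_harmonic R; exact.
  by rewrite sub0r normrN ger0_norm.
have mW m : measurable_fun setT (W m).
  apply: (tail_residual_measurable HS q_gt0 q_lt1 Hc).
  by rewrite invr_gt0 ltr0n; exact: leq_ltn_trans (mesh_gt m).
have WK m w : `|W m w| <= K by exact: V_bound.
pose D := ~` level x.
have mD : measurable D by exact: measurableC.
pose lim w : R := \1_(above x) w.
have lim1 w : `|lim w| <= 1 by rewrite /lim indicE; case: (_ \in _); rewrite ?normr1 ?normr0.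
have mlim : measurable_fun setT lim by exact: measurable_indic.
have W_lim : \int[P]_(w in D) W m w @[m --> \oo] --> \int[P]_(w in D) lim w.
  apply: (bounded_convergence mD mW mlim WK) => w Dw; rewrite /lim indicE.
  have [xI|Ix|Ix] := ltgtP x%:E (I w).
  - by rewrite mem_set//; exact: tail_residual_above.
  - rewrite memNset; first exact: tail_residual_below.
    by rewrite /above/=; apply/negP; rewrite -leNgt ltW.
  - by exfalso; apply: Dw; rewrite /level/= -Ix.
have lim_above : \int[P]_(w in D) lim w = fine (P (above x)).
  rewrite (_ : above x = D `&` above x); last first.
    apply/seteqP; split=> [w xI|w []//]; split => // Ix.
    by move: xI; rewrite /above/= Ix ltxx.
  rewrite /lim -[RHS]mul1r -Rintegral_cst; last exact: measurableI.
  rewrite Rintegral_mkcondr; apply: eq_Rintegral => w _.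
  by rewrite patchE indicE; case: (_ \in _).
rewrite -lim_above;
have norm_lim : `|\int[P]_w W m w - \int[P]_(w in D) W m w| @[m --> \oo] -->
    `|V x - \int[P]_(w in D) lim w| by exact: cvg_norm (cvgB W_V W_lim).
rewrite -(cvg_lim _ norm_lim)//; apply: limr_le.
  by apply/cvg_ex; exists `|V x - \int[P]_(w in D) lim w|.
apply: nearW => m /=.
rewrite (Rintegral_setIC P measurableT (level_measurable x) (mW m) (WK m)).
rewrite !setTI addrK; apply: bounded_Rintegral_le => // w _; exact: WK.
Unshelve. all: by end_near. Qed.

(** Since [P (I = y)] is at most [P (x < I) - P (y < I)] for [x < y], the error
    disappears in the limit from the right. *)
Lemma tail_funE x : fine (P (above x)) = V x.
Proof.
pose y (n : nat) : R := x + n.+1%:R^-1.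
have xy n : x < y n by rewrite ltrDl invr_gt0.
have yx : y n @[n --> \oo] --> x.
  rewrite -[X in _ --> X]addr0; apply: cvgD; first exact: cvg_cst.
  exact: cvg_harmonic.
have above_lim : P (above (y n)) @[n --> \oo] --> P (above x).
  have -> : above x = \bigcup_n above (y n).
    apply/seteqP; split=> w; last first.
      by move=> [n _]; rewrite /above/=; apply: lt_trans; rewrite lte_fin.
    rewrite /above/=; case EI : (I w) => [r| |]; last by rewrite ltNge leNye.
      rewrite lte_fin => xr; have xr0 : 0 < r - x by rewrite subr_gt0.
      move/cvgrPdist_lt : (yx) => /(_ _ xr0)[n _ Hn].
      exists n => //=; rewrite EI lte_fin; have := Hn n (leqnn n).
      by rewrite /= ltr_norml => /andP[+ _]; lra.
    by move=> _; exists 0%N => //=; rewrite EI ltry.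
  apply: nondecreasing_cvg_mu => //; first exact: bigcup_measurable.
  move=> m n mn; apply/subsetPset => w; rewrite /above/=.
  apply: le_lt_trans; rewrite lee_fin lerD2l lef_pV2 ?posrE//.
  by rewrite ler_nat ltnS.
have p_lim : fine (P (above (y n))) @[n --> \oo] --> fine (P (above x)).
  by apply: fine_cvg; rewrite fineK ?fin_num_measure.
have V_lim : V (y n) @[n --> \oo] --> V x.
  by apply: continuous_cvg => //; exact: V_continuous.
have level_le n : fine (P (level (y n))) <= fine (P (above x)) - fine (P (above (y n))).
  have mU : measurable (level (y n) `|` above (y n)) by exact: measurableU.
  rewrite lerBrDr -fineD ?fin_num_measure// -measureU//; last first.
    by apply/seteqP; split=> // w []; rewrite /level/above/= => ->; rewrite ltxx.
  apply: fine_le; rewrite ?fin_num_measure//.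
  apply: le_measure; rewrite ?inE// => w [] /=; rewrite /level/above/=.
    by move=> ->; rewrite lte_fin.
  by apply: lt_trans; rewrite lte_fin.
have err0 : V (y n) - fine (P (above (y n))) @[n --> \oo] --> (0 : R).
  apply/cvgr0Pnorm_le => eps eps0; have K1 : 0 < K + 1 by rewrite ltr_wpDl.
  have ek : 0 < eps / (K + 1) by rewrite divr_gt0.
  near=> n.
  apply: le_trans (tail_fun_approx (y n)) _.
  apply: le_trans (ler_wpM2l K_ge0 (level_le n)) _.
  have : `|fine (P (above x)) - fine (P (above (y n)))| <= eps / (K + 1).
    by near: n; move/cvgrPdist_le : p_lim; exact.
  rewrite ler_pdivlMr// mulrC => H.
  apply: le_trans (ler_wpM2l K_ge0 (ler_norm _)) (le_trans _ H).
  by rewrite ler_wpM2r// lerDl.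
apply/esym/eqP; rewrite -subr_eq0; apply/eqP.
exact: (cvg_unique _ (cvgB V_lim p_lim) err0).
Unshelve. all: by end_near. Qed.

(** [P (I = +oo)] is at most every [P (x < I) = V x], and [V] vanishes at
    infinity. *)
Lemma exp_functional_infinite_null : P [set w | I w = +oo%E] = 0%E.
Proof.
have mtop : measurable [set w | I w = +oo%E].
  rewrite -[X in measurable X]setTI -[X in _ `&` X]/(I @^-1` [set +oo%E]).
  exact: exp_functional_measurable.
rewrite -[LHS]fineK ?fin_num_measure//; congr _%:E.
apply/eqP; rewrite eq_le fine_ge0// andbT; apply/ler_addgt0Pr => eps eps0; rewrite add0r.
pose x := K / (eps * a).
have x0 : 0 <= x by apply: divr_ge0 => //; apply: mulr_ge0; exact: ltW.
apply: (@le_trans _ _ (V x)).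
  rewrite -tail_funE; apply: fine_le; rewrite ?fin_num_measure//.
  by apply: le_measure; rewrite ?inE// => w /= Ioo; rewrite /above/= Ioo ltry.
apply: le_trans (ler_norm _) (tail_fun_small eps0 _ x0).
rewrite [leRHS](_ : _ = K)// /x; field.
by rewrite ?(gt_eqF a_gt0) ?(gt_eqF eps0).
Qed.

Lemma tail_fun_nonincreasing x y : x <= y -> V y <= V x.
Proof.
move=> xy; rewrite -!tail_funE; apply: fine_le; rewrite ?fin_num_measure//.
apply: le_measure; rewrite ?inE// => w /=; rewrite /above/=.
by apply: le_lt_trans; rewrite lee_fin.
Qed.

(** The sign is that of minus the derivative of the probabilities [P (x < I)]. *)
Lemma density_fun_ge0 x : 0 <= f x.
Proof.
apply/ler_addgt0Pr => eps eps0.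
have [delta d0 Hd] := tail_fun_expansion q_gt0 q_lt1 a_gt0 sc D_gt0 sum0 eps0.
have := Hd x delta; rewrite d0 lexx => /(_ isT).
have := @tail_fun_nonincreasing x (x + delta); rewrite lerDl (ltW d0) => /(_ isT).
rewrite ler_norml => H /andP[H1 _].
rewrite -(pmulr_rge0 _ d0) mulrDr; lra.
Qed.

Lemma density_fun_measurable : measurable_fun setT f.
Proof.
apply: continuous_measurable_fun.
exact: (density_fun_continuous q_gt0 a_gt0 sc D_gt0 sum0).
Qed.

Lemma density_fun_ray x :
  (\int[@lebesgue_measure R]_(y in `]x, +oo[) (f y)%:E)%E = (V x)%:E.
Proof.
have cf := density_fun_continuous q_gt0 a_gt0 sc D_gt0 sum0.
have dV y := tail_fun_derive q_gt0 q_lt1 a_gt0 sc D_gt0 sum0 y.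
rewrite integral_itv_obnd_cbnd; last first.
  by apply/measurable_funTS/measurable_EFinP; exact: density_fun_measurable.
rewrite (@ge0_continuous_FTC2y _ f (- V) x 0).
- by rewrite sub0e -EFinN opprK.
- by move=> y _; exact: density_fun_ge0.
- exact: continuous_subspaceT.
- rewrite -oppr0; apply: cvgN.
  apply/cvgrPdist_le => eps eps0; near=> y; rewrite sub0r normrN.
  have y0 : 0 <= y by near: y; exact: nbhs_pinfty_ge.
  have Ky : K / (eps * a) <= y by near: y; apply: nbhs_pinfty_ge; exact: num_real.
  apply: tail_fun_small => //; rewrite mulrA mulrC -ler_pdivrMr//.
  exact: mulr_gt0.
- by move=> y _; apply: derivableN; case: (dV y).
- by apply: cvgN; apply: cvg_at_right_filter; exact: V_continuous.
- move=> y _; rewrite derive1E deriveN; last by case: (dV y).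
  by case: (dV y) => _ ->; rewrite opprK.
Unshelve. all: by end_near. Qed.

Lemma exp_functional_has_density : has_density P I f.
Proof.
have mY : measurable_fun setT (fine \o I).
  by apply: measurableT_comp => //; exact: exp_functional_measurable.
have mtop : measurable [set w | I w = +oo%E].
  rewrite -[X in measurable X]setTI -[X in _ `&` X]/(I @^-1` [set +oo%E]).
  exact: exp_functional_measurable.
have finE w : I w <> +oo%E -> I w = (fine (I w))%:E.
  move=> Ioo; rewrite fineK// ge0_fin_numE ?exp_functional_ge0//.
  by rewrite ltey; apply/eqP.
(* The density describes the law of [fine (I w)], which differs from [I w] on
   a null set only. *)
have null (A B : set T) : measurable A -> measurable B ->
    (forall w, I w <> +oo%E -> A w <-> B w) -> P A = P B.
  move=> mA mB AB; pose F := ~` [set w | I w = +oo%E].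
  have mF : measurable F by exact: measurableC.
  have cut C : measurable C -> P C = P (C `&` F).
    move=> mC; rewrite (measureDI P mC mF) [X in (X + _)%E](_ : _ = 0%E) ?add0e//.
    apply: (@subset_measure0 _ _ _ P _ [set w | I w = +oo%E]) => //.
    - exact: measurableD.
    - by move=> w [_ /contrapT].
    - exact: exp_functional_infinite_null.
  rewrite cut// [RHS]cut//; congr (P _); apply/seteqP.
  by split=> w [? Fw]; split=> //; apply/(AB w Fw).
have mpre (A : set R) : measurable A -> measurable ((fine \o I) @^-1` A).
  by move=> mA; rewrite -[X in measurable X]setTI; exact: mY.
split.
- exact: exp_functional_measurable.
- exists [set w | I w = +oo%E]; split => //; first exact: exp_functional_infinite_null.
  by move=> w nfin /=; apply: contrapT => /finE Iw; apply: nfin; rewrite /= Iw.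
- exact: density_fun_measurable.
- exact: density_fun_ge0.
- have ray x : P [set w | x < (fine \o I) w] =
      (\int[@lebesgue_measure R]_(y in `]x, +oo[) (f y)%:E)%E.
    rewrite density_fun_ray -tail_funE fineK ?fin_num_measure//.
    apply: null => //.
      have := mpre _ (measurable_itv `]x, +oo[); congr measurable.
      by apply/seteqP; split=> w; rewrite /preimage/= in_itv/= andbT.
    by move=> w /finE Iw; rewrite /above/= [in X in _ <-> X]Iw lte_fin.
  move=> A mA.
  rewrite -(@density_from_rays _ _ _ P _ _ mY density_fun_measurable density_fun_ge0 ray A mA).
  apply: null.
  + rewrite -[X in measurable X]setTI; apply: exp_functional_measurable => //.
    exact: measurable_image_EFin.
  + exact: mpre.
  + move=> w /finE Iw; rewrite /preimage/=; split.
      by move=> [r Ar rI]; rewrite -rI.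
    by move=> Aw; exists (fine (I w)).
Qed.

End Law.

Theorem theorem3p1 (d : measure_display) (T : measurableType d) (R : realType)
    (P : probability T R) (lam q : R) (N : R -> T -> nat)
    (Z : nat -> T -> nat) (S : R -> T -> nat) (c : nat -> R)
    (HS : integer_valued_subordinator P lam N Z S)
    (q_gt0 : 0 < q) (q_lt1 : q < 1)
    (Hc : coef_recurrence q (fun k => fine (P [set w | Z 0%N w = k]))
                          (fine (P [set w | (1 <= Z 0%N w)%N])) c) :
  let p1 := fine (P [set w | (1 <= Z 0%N w)%N]) in
  [/\ cvgn (series (normalizer_term q c)),
      limn (series (normalizer_term q c)) != 0,
      (forall x : R, 0 < x -> cvgn (series (phi_term q lam p1 c x))) &
      has_density P (exponential_functional q S)
        (fun x : R => if 0 < x then phi q lam p1 c x else 0)].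
Proof.
move=> p1; have p1_gt0 := p1_gt0 HS; have mZ := ivs_measurable HS 0%N.
have sc := coef_summable q_gt0 q_lt1 mZ p1_gt0 Hc.
have a_gt0 : 0 < lam * p1 by apply: mulr_gt0 => //; exact: ivs_intensity HS.
have sum0 := sum_coef_eq0 q_gt0 q_lt1 mZ p1_gt0 Hc.
split.
- exact: pairing_cvg sc (expq_le1 q_gt0 q_lt1).
- exact: lt0r_neq0 (normalizer_gt0 q_gt0 q_lt1 mZ p1_gt0 Hc).
- by move=> x x0; apply: pairing_cvg sc (fun j => decay_le1 q_gt0 a_gt0 j (ltW x0)).
- rewrite (_ : (fun x => _) = density_fun q (lam * p1) c).
    exact: exp_functional_has_density HS q_gt0 q_lt1 Hc.
  apply/funext => x; case: ltP => x0; first by rewrite density_fun_ge0E// ltW.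
  by rewrite density_fun_le0.
Qed.
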